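(* Let $p$ be a prime and let $r$ be an integer with $1\le r\le p$. Then for every $d\ge0$ the elementary divisors of the form $\langle\cdot,\cdot\rangle_{p^r}$ on the $d$th graded component of $\Lambda$ are $$\{D_r(\lambda) : \lambda\vdash d\}$$ (a multiset indexed by the partitions $\lambda$ of $d$).
   Context: $\Lambda$ is the graded ring of symmetric functions over $\mathbb Z$. For a positive integer $s$, $\langle\cdot,\cdot\rangle_s$ is the symmetric bilinear form on $\mathbb C\otimes\Lambda$ given on power sums by $\langle p_\lambda,p_\mu\rangle_s=\delta_{\lambda\mu}s^{l(\lambda)}z_\lambda$, with $l(\lambda)$ the number of parts of $\lambda$ and $z_\lambda=\prod_{k\ge1}k^{m_k}m_k!$ for $\lambda=(1^{m_1}2^{m_2}\cdots)$; it restricts to a $\mathbb Z$-valued form on $\Lambda$. The elementary divisors of the form on a graded component are the diagonal entries (with multiplicity) of the Smith normal form of its Gram matrix in a $\mathbb Z$-basis. For an integer $a\ge0$ set $d_p(a)=\sum_{j\ge1}\lfloor a/p^j\rfloor$. For a partition $\lambda=(1^{m_1(\lambda)}2^{m_2(\lambda)}\cdots)$ set $$D_r(\lambda)=\prod_{(n,p)=1}\ \prod_{i=0}^{r-1}p^{(r-i)m_{p^in}(\lambda)+d_p(m_{p^in}(\lambda))},$$ the outer product being over positive integers $n$ prime to $p$. *)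

(* Defs.v *)
From HB Require Import structures.
From mathcomp Require Import all_boot all_order all_algebra.
From mathcomp Require Import perm sesquilinear mpoly complex boolp reals.

Set Implicit Arguments.
Unset Strict Implicit.
Unset Printing Implicit Defensive.

Import Order.TTheory GRing.Theory Num.Theory.

Local Open Scope ring_scope.

(** Integer partitions are nonincreasing sequences of positive integers; the
    multiplicity m_k(l) of the part k is [count_mem k l] and the length of l is
    [size l]. *)

Definition is_part (l : seq nat) : bool := sorted geq l && (0%N \notin l).

Record intpart (d : nat) := IntPart {
  parts :> seq nat;
  _ : is_part parts && (sumn parts == d)
}.

HB.instance Definition _ d := [isSub for @parts d].
HB.instance Definition _ d := [Countable of intpart d by <:].

Section IntPartFinite.
Variable d : nat.

Lemma size_le_sumn (l : seq nat) : 0%N \notin l -> (size l <= sumn l)%N.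
Proof.
elim: l => //= x l IHl; rewrite in_cons negb_or eq_sym => /andP[x0 /IHl].
by rewrite -lt0n in x0; rewrite -[(size l).+1]add1n; apply: leq_add.
Qed.

Lemma mem_le_sumn (l : seq nat) k : k \in l -> (k <= sumn l)%N.
Proof.
elim: l => //= x l IHl; rewrite in_cons => /predU1P[->|/IHl le_k].
  exact: leq_addr.
exact: leq_trans le_k (leq_addl _ _).
Qed.

Definition intpart_code (l : intpart d) : d.-bseq 'I_d.+1 :=
  insub_bseq d [seq inord k | k <- l].

Definition intpart_decode (t : d.-bseq 'I_d.+1) : option (intpart d) :=
  insub [seq val i | i <- t].

Lemma intpart_codeK : pcancel intpart_code intpart_decode.
Proof.
case=> l pl; rewrite /intpart_code /intpart_decode /=.
have /andP[/andP[_ l0] /eqP sl] := pl.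
have size_l : (size [seq inord k : 'I_d.+1 | k <- l] <= d)%N.
  by rewrite size_map; apply: leq_trans (size_le_sumn l0) _; rewrite sl.
rewrite /insub_bseq insubdK // -map_comp map_id_in ?insubT // => k kl /=.
by rewrite inordK // ltnS -sl mem_le_sumn.
Qed.

HB.instance Definition _ : isFinite (intpart d) := PCanIsFinite intpart_codeK.

End IntPartFinite.

Notation "''P_' d" := (intpart d)
  (at level 8, d at level 2, format "''P_' d") : type_scope.

Definition zpart (l : seq nat) : nat :=
  (\prod_(k <- undup l) (k ^ count_mem k l * (count_mem k l)`!))%N.

(* The terms with j > a vanish since p ^ j > a. *)
Definition dp (p a : nat) : nat := (\sum_(1 <= j < a.+1) a %/ p ^ j)%N.

(* The factors with n > |l| are equal to 1. *)
Definition Dpart (p r : nat) (l : seq nat) : nat :=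
  (\prod_(1 <= n < (sumn l).+1 | coprime n p) \prod_(0 <= i < r)
     p ^ ((r - i) * count_mem (p ^ i * n) l
          + dp p (count_mem (p ^ i * n) l)))%N.

(** Symmetric functions over R, as the graded inverse limit of the rings of
    symmetric polynomials in x_0, ..., x_{n-1}. *)

(* All families (f_n)_n of polynomials, with pointwise operations. *)
Definition polyfam (R : comNzRingType) : Type := forall n, {mpoly R[n]}.

Section PolyFam.
Variable R : comNzRingType.
Implicit Types f g h : polyfam R.

HB.instance Definition _ := gen_eqMixin (polyfam R).
HB.instance Definition _ := gen_choiceMixin (polyfam R).

Lemma polyfamP f g : (forall n, f n = g n) -> f = g.
Proof. by move=> fg; apply: functional_extensionality_dep. Qed.

Definition pf_zero : polyfam R := fun n => 0.
Definition pf_opp f : polyfam R := fun n => - f n.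
Definition pf_add f g : polyfam R := fun n => f n + g n.
Definition pf_one : polyfam R := fun n => 1.
Definition pf_mul f g : polyfam R := fun n => f n * g n.
Definition pf_scale (a : R) f : polyfam R := fun n => a *: f n.

Fact pf_addA : associative pf_add.
Proof. by move=> f g h; apply: polyfamP => n; apply: addrA. Qed.
Fact pf_addC : commutative pf_add.
Proof. by move=> f g; apply: polyfamP => n; apply: addrC. Qed.
Fact pf_add0 : left_id pf_zero pf_add.
Proof. by move=> f; apply: polyfamP => n; apply: add0r. Qed.
Fact pf_addN : left_inverse pf_zero pf_opp pf_add.
Proof. by move=> f; apply: polyfamP => n; apply: addNr. Qed.
HB.instance Definition _ :=
  GRing.isZmodule.Build (polyfam R) pf_addA pf_addC pf_add0 pf_addN.

Fact pf_mulA : associative pf_mul.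
Proof. by move=> f g h; apply: polyfamP => n; apply: mulrA. Qed.
Fact pf_mulC : commutative pf_mul.
Proof. by move=> f g; apply: polyfamP => n; apply: mulrC. Qed.
Fact pf_mul1 : left_id pf_one pf_mul.
Proof. by move=> f; apply: polyfamP => n; apply: mul1r. Qed.
Fact pf_mulDl : left_distributive pf_mul +%R.
Proof. by move=> f g h; apply: polyfamP => n; apply: mulrDl. Qed.
Fact pf_one_neq0 : pf_one != 0.
Proof.
apply/eqP => /(congr1 (fun f : polyfam R => f 0%N)) /eqP.
by rewrite [X in _ == X]/(0 : {mpoly R[0]}) oner_eq0.
Qed.
HB.instance Definition _ := GRing.Zmodule_isComNzRing.Build (polyfam R)
  pf_mulA pf_mulC pf_mul1 pf_mulDl pf_one_neq0.

Fact pf_scaleA a b f : pf_scale a (pf_scale b f) = pf_scale (a * b) f.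
Proof. by apply: polyfamP => n; apply: scalerA. Qed.
Fact pf_scale1 : left_id 1 pf_scale.
Proof. by move=> f; apply: polyfamP => n; apply: scale1r. Qed.
Fact pf_scaleDr : right_distributive pf_scale +%R.
Proof. by move=> a f g; apply: polyfamP => n; apply: scalerDr. Qed.
Fact pf_scaleDl f : {morph pf_scale^~ f : a b / a + b}.
Proof. by move=> a b; apply: polyfamP => n; apply: scalerDl. Qed.
HB.instance Definition _ := GRing.Zmodule_isLmodule.Build R (polyfam R)
  pf_scaleA pf_scale1 pf_scaleDr pf_scaleDl.

Fact pf_scaleAl (a : R) f g : a *: (f * g) = (a *: f) * g.
Proof. by apply: polyfamP => n; apply: scalerAl. Qed.
HB.instance Definition _ :=
  GRing.Lmodule_isLalgebra.Build R (polyfam R) pf_scaleAl.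
HB.instance Definition _ :=
  GRing.Lalgebra_isComAlgebra.Build R (polyfam R).

End PolyFam.

(* Setting the last variable to zero. *)
Definition drop_last_var (R : comNzRingType) (n : nat) :
    {mpoly R[n.+1]} -> {mpoly R[n]} :=
  comp_mpoly
    [tuple if unlift ord_max i is Some j then 'X_j else 0 | i < n.+1].

Definition is_symfun (R : comNzRingType) (f : polyfam R) : Prop :=
  [/\ forall n, f n \is symmetric,
      forall n, drop_last_var (f n.+1) = f n
    & exists k, forall n, (msize (f n) <= k)%N].

Definition symfun_pred (R : comNzRingType) : {pred polyfam R} :=
  fun f => `[< is_symfun f >].

Fact symfun_subalg_closed (R : comNzRingType) :
  GRing.subalg_closed (@symfun_pred R).
Proof.
split.
- apply/asboolP; split=> [n|n|]; [exact: rpred1 | exact: rmorph1 |].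
  by exists 1%N => n; rewrite msize1.
- move=> a f g /asboolP[sf rf [k bf]] /asboolP[sg rg [l bg]].
  apply/asboolP; split=> [n|n|].
  + by apply: rpredD (sg n); apply: rpredZ (sf n).
  + transitivity (a *: drop_last_var (f n.+1) + drop_last_var (g n.+1)).
      exact: linearP.
    by rewrite rf rg.
  + exists (maxn k l) => n; apply: (leq_trans (msizeD_le _ _)).
    rewrite geq_max !leq_max bg orbT andbT.
    by rewrite (leq_trans (msizeZ_le _ _)).
- move=> f g /asboolP[sf rf [k bf]] /asboolP[sg rg [l bg]].
  apply/asboolP; split=> [n|n|].
  + exact: rpredM (sf n) (sg n).
  + transitivity (drop_last_var (f n.+1) * drop_last_var (g n.+1)).
      exact: rmorphM.
    by rewrite rf rg.
  + exists (k + l).+1%N => n; apply: (leq_trans (msizeM_le _ _)).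
    by rewrite ltnS leq_add.
Qed.
HB.instance Definition _ (R : comNzRingType) :=
  GRing.isSubalgClosed.Build R (polyfam R) (@symfun_pred R)
    (@symfun_subalg_closed R).

Record symfun (R : comNzRingType) := SymFun {
  symfun_val : polyfam R;
  _ : symfun_val \in @symfun_pred R
}.

HB.instance Definition _ (R : comNzRingType) := [isSub for @symfun_val R].
HB.instance Definition _ (R : comNzRingType) := [Choice of symfun R by <:].
HB.instance Definition _ (R : comNzRingType) :=
  [SubChoice_isSubComNzRing of symfun R by <:].
HB.instance Definition _ (R : comNzRingType) :=
  [SubZmodule_isSubLmodule of symfun R by <:].
HB.instance Definition _ (R : comNzRingType) :=
  [SubNzRing_SubLmodule_isSubLalgebra of symfun R by <:].
HB.instance Definition _ (R : comNzRingType) :=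
  [SubLalgebra_isSubAlgebra of symfun R by <:].

Definition in_degree (R : comNzRingType) (d : nat) (f : symfun R) : Prop :=
  forall n, symfun_val f n \is d.-homog.

Section PowerSums.
Variable R : comNzRingType.

(* The power sum of degree k for k > 0: the predecessor only serves to make
   the definition total, as the family of constants n = sum x_i ^ 0 is not
   compatible with the restrictions. *)
Definition psum_fam (k : nat) : polyfam R :=
  fun n => \sum_(i < n) 'X_i ^+ k.-1.+1.

Fact psum_subproof k : psum_fam k \in @symfun_pred R.
Proof.
apply/asboolP; split=> [n|n|].
- apply/issymP => s; rewrite /psum_fam raddf_sum /=.
  rewrite [RHS](reindex_inj (@perm_inj _ s)) /=.
  apply: eq_bigr => i _; rewrite rmorphXn /= msymX.
  congr (_ ^+ _); congr ('X_[_]); apply/mnmP => j.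
  by rewrite !mnmE -(inj_eq (@perm_inj _ s)) permKV.
- rewrite /psum_fam /drop_last_var raddf_sum big_ord_recr /=.
  rewrite rmorphXn /= comp_mpolyXU -tnth_nth tnth_mktuple unlift_none expr0n.
  rewrite addr0; apply: eq_bigr => i _.
  rewrite rmorphXn /= comp_mpolyXU -tnth_nth tnth_mktuple.
  have -> : widen_ord (leqnSn n) i = lift ord_max i.
    by apply: val_inj; rewrite /= /bump leqNgt ltn_ord.
  by rewrite liftK.
- exists k.+2 => n; apply: leq_trans (msize_sum _ _ _) _.
  apply/bigmax_leqP => i _; rewrite mpolyXn msizeX mdegMn mdeg1 mul1n.
  by case: k.
Qed.

Definition psum (k : nat) : symfun R := SymFun (psum_subproof k).

Definition psum_part (l : seq nat) : symfun R := \prod_(k <- l) psum k.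

End PowerSums.

Section BaseChange.
Variable R : numDomainType.

Definition int_base_change_fam (f : symfun int) : polyfam R :=
  fun n => map_mpoly (intr : int -> R) (symfun_val f n).

Fact int_base_change_subproof f :
  int_base_change_fam f \in @symfun_pred R.
Proof.
have inj_intr : injective (intr : int -> R) by apply: intr_inj.
have [sf rf [k bf]] : is_symfun (symfun_val f) by case: f => f /= /asboolP.
apply/asboolP; split=> [n|n|].
- apply/issymP => s; apply/mpolyP => m.
  by rewrite mcoeff_sym !mcoeff_map_mpoly /= -mcoeff_sym (issymP _ (sf n)).
- rewrite /int_base_change_fam -[in RHS](rf n).
  rewrite /drop_last_var [RHS]map_mpoly_comp //; congr comp_mpoly.
  apply: eq_from_tnth => i; rewrite [RHS]tnth_map !tnth_mktuple.
  by case: unlift => [j|]; rewrite ?raddf0 // map_mpolyX.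
- exists k => n; rewrite /int_base_change_fam /= mmeasureE.
  by rewrite (perm_big _ (msupp_map_mpoly _ inj_intr)) -mmeasureE.
Qed.

(* The map f |-> 1 (x) f, under the identification of R (x) symfun int with
   symfun R. *)
Definition int_base_change (f : symfun int) : symfun R :=
  SymFun (int_base_change_subproof f).

End BaseChange.

Definition is_scaled_form (C : comNzRingType) (s : nat)
    (form : symfun C -> symfun C -> C) : Prop :=
  (forall f g, form f g = form g f) /\
  forall l m : seq nat, is_part l -> is_part m ->
    form (psum_part C l) (psum_part C m) =
      if l == m then (s ^ size l * zpart l)%:R else 0.

Definition is_Zbasis (d N : nat) (b : 'I_N -> symfun int) : Prop :=
  (forall i, in_degree d (b i)) /\
  forall f, in_degree d f -> exists! c : 'rV[int]_N, f = \sum_i c 0 i *: b i.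

Definition gram (C : numDomainType) (form : symfun C -> symfun C -> C)
    (N : nat) (b : 'I_N -> symfun int) : 'M[C]_N :=
  \matrix_(i, j) form (int_base_change C (b i)) (int_base_change C (b j)).

(* The normal form is that of [int_Smith_normal_form]. *)
Definition smith_divisors (N : nat) (G : 'M[int]_N) (e : seq int) : Prop :=
  exists (L D : 'M[int]_N) (d : seq int),
    [/\ L \in unitmx, D \in unitmx,
        [/\ size d = N, sorted dvdz d & all (fun x => 0 <= x) d],
        G = L *m (\matrix_(i, j) (d`_i *+ (i == j :> nat))) *m D
      & perm_eq d e].

Definition elementary_divisors (C : numDomainType)
    (form : symfun C -> symfun C -> C) (d : nat) (e : seq int) : Prop :=
  (exists (N : nat) (b : 'I_N -> symfun int), is_Zbasis d b) /\
  forall (N : nat) (b : 'I_N -> symfun int), is_Zbasis d b ->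
    exists2 G : 'M[int]_N, map_mx intr G = gram form b & smith_divisors G e.

(* Main.v *)
From HB Require Import structures.
Require Import Defs.
From mathcomp Require Import all_boot all_order all_algebra.
From mathcomp Require Import fingroup perm zify ring.
From mathcomp Require Import sesquilinear mpoly complex boolp reals.

Set Implicit Arguments.
Unset Strict Implicit.
Unset Printing Implicit Defensive.

Import Order.TTheory GRing.Theory Num.Theory.

Local Open Scope ring_scope.

(** Below e_k stands for the elementary symmetric function up to the sign (-1) ^ k
    ([sesym]). Let s = p ^ r, and let Psi be the endomorphism of the ring of symmetric functions
    with Psi(p_k) = s p_k. Concretely Psi repeats each variable s times, so it is
    defined over the integers ([repeated]). One has <f, g>_s = <f, Psi g>_1, and the
    complete functions h_l are dual to the monomial ones: <h_l, f>_s is the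
    coefficient of x ^ l in Psi(f) ([form_complete]). Hence in the basis of the
    products e_l of elementary functions the Gram matrix is, up to an invertible
    factor, the matrix of the coefficients of the Psi(e_l) ([gram_sesym]). Its
    determinant is s to the total number of parts of the partitions of d, up to sign,
    since the products p_l of power sums are eigenvectors of Psi
    ([det_coef_mx_repeated]).

    It is enough to find, for each partition l, an element x_l of degree d congruent to
    e_l modulo p and such that D_r(l) divides Psi(x_l): the elementary divisors are
    then at least the D_r(l), in a suitable order, and if the product of the D_r(l) is
    the determinant there is no room left
    ([smith_divisors_of_divisible_family]).

    Newton's identities say that k e_k is a combination of products p_i e_(k-i). So
    p ^ r divides k Psi(e_k), and p ^ (r - v) divides Psi(e_k) if the valuation v of k
    is at most r ([sesym_divisible]). To gain more on the powers of e_k, let F be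
    the substitution x_i |-> x_i ^ p. It commutes with Psi, and F(f) is congruent to
    f ^ p modulo p. If Psi(f) = p ^ c y with c > 0, then
    f' = f ^ p - p ^ ((p - 1) c) F(f) is congruent to f ^ p modulo p, and Psi(f') is
    p ^ (p c) (y ^ p - F(y)), which p ^ (p c + 1) divides ([divisible_lift_step]).
    Starting from e_k with v < r, this yields substitutes of the e_k ^ (p ^ j); taking
    products along the base p digits of m, one gets an element congruent to e_k ^ m
    whose image is divisible by p to the power (r - v) m + d_p(m)
    ([divisible_lift_exp]). The products of these over k are the x_l.

    It remains to compare the product of the D_r(l) with the determinant. Removing
    copies of a part shows that the number of partitions of d with at least j parts k
    only depends on j k ([card_count_ge]). So the sum over l of the quotients
    m_k(l) / p ^ a, rounded down, is the sum of the m_(k p ^ a)(l), and the total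
    exponent is r times the total number of parts ([sum_part_exponent]). *)

(** * Smith normal forms from a divisible family *)

Lemma absz_unit (x : int) : x \is a GRing.unit -> `|x|%N = 1%N.
Proof. by case/orP => /eqP ->. Qed.

Lemma det_nondvd_perm (p : nat) (N : nat) (A : 'M[int]_N) :
  prime p -> ~~ (p%:Z %| \det A)%Z ->
  exists s : 'S_N, forall i, ~~ (p%:Z %| A i (s i))%Z.
Proof.
move=> pp pA; apply: contrapT => noS; case/negP: pA; rewrite /determinant.
elim/big_ind: _ => [|x y|s _]; [exact: dvdz0 | exact: rpredD |].
apply: dvdz_mull.
have [i Hi] : exists i, (p%:Z %| A i (s i))%Z.
  apply: contrapT => noi; apply: noS; exists s => i.
  by apply/negP => di; apply: noi; exists i.
by rewrite (bigD1 i) //= dvdz_mulr.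
Qed.

(** The determinant forces the Smith form of G = L D R to be a diagonal of powers
    p ^ e i, and G X = Y diag (p ^ c) becomes D (R X) = Y' diag (p ^ c). As the
    determinant of R X is prime to p, some permutation s has all the entries
    (R X) i (s i) prime to p, whence c (s i) <= e i. The sums of c and e agree, so
    c (s i) = e i. *)
Lemma smith_divisors_of_divisible_family (p N : nat) (G X Y : 'M[int]_N)
    (c : 'I_N -> nat) :
  prime p -> ~~ (p%:Z %| \det X)%Z ->
  G *m X = Y *m diag_mx (\row_i (p ^ c i)%:Z) ->
  `|\det G|%N = (p ^ \sum_i c i)%N ->
  smith_divisors G [seq (p ^ c i)%:Z | i : 'I_N].
Proof.
move=> pp pX GX detG.
have [L uL [R uR [d0 sd0 defG]]] := int_Smith_normal_form G.
(* The diagonal of the Smith form is only known up to signs, which go into L. *)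
pose a i : nat := absz (nth 0 d0 i).
pose d : seq int := [seq Posz (a i) | i <- iota 0 N].
pose S : 'M[int]_N := diag_mx (\row_i (if d0`_i < 0 then -1 else 1)).
have nd (i : 'I_N) : d`_i = Posz (a i).
  by rewrite /d (nth_map 0%N) ?size_iota ?nth_iota // ltn_ord.
have uS : S \in unitmx.
  rewrite unitmxE det_diag rpred_prod // => i _; rewrite mxE.
  by case: ifP; rewrite ?unitrN unitr1.
pose D := \matrix_(i, j) (d`_i *+ (i == j :> nat)) : 'M[int]_N.
have DE : D = diag_mx (\row_i d`_i).
  by apply/matrixP => i j; rewrite !mxE -val_eqE /=; case: eqP.
have defG' : G = (L *m S) *m D *m R.
  rewrite defG; congr (_ *m _); rewrite -mulmxA; congr (_ *m _).
  apply/matrixP => i j; rewrite mul_diag_mx !mxE nd.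
  case: (i =P j :> nat) => _; last by rewrite !mulr0n mulr0.
  rewrite !mulr1n; rewrite /a; case: ltP => h; lia.
have [e de] : exists e : 'I_N -> nat, forall i : 'I_N, d`_i = (p ^ e i)%:Z.
  have dd (i : 'I_N) : exists e, d`_i == (p ^ e)%:Z.
    have : (a i %| p ^ \sum_i c i)%N.
      have -> : a i = absz (nth 0 d i) by rewrite nd.
      rewrite -detG defG' !det_mulmx DE (det_diag (\row_i d`_i)) (bigD1 i) //= mxE.
      by rewrite !abszM; apply: dvdn_mulr; apply: dvdn_mull; apply: dvdn_mulr.
    by case/(dvdn_pfactor _ _ pp) => m _ hm; exists m; rewrite nd hm.
  by exists (fun i => xchoose (dd i)) => i; apply/eqP/(xchooseP (dd i)).
have sume : \sum_i e i = \sum_i c i.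
  apply: (@expnI p); first exact: prime_gt1.
  rewrite -detG defG' !det_mulmx DE (det_diag (\row_i d`_i)) !abszM.
  have abs1 (A : 'M[int]_N) : A \in unitmx -> `|\det A|%N = 1%N.
    by rewrite unitmxE => /absz_unit.
  rewrite !abs1 // mul1n mul1n muln1 expn_sum (big_morph absz abszM absz1).
  by apply: eq_bigr => i _; rewrite mxE de absz_nat.
have uLS : L *m S \in unitmx by rewrite unitmx_mul uL.
have key : D *m (R *m X) = invmx (L *m S) *m Y *m diag_mx (\row_i (p ^ c i)%:Z).
  have GXE : G *m X = (L *m S) *m (D *m (R *m X)) by rewrite defG' !mulmxA.
  by rewrite -[RHS]mulmxA -GX GXE mulKmx.
have [s hs] : exists s : 'S_N, forall i, ~~ (p%:Z %| (R *m X) i (s i))%Z.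
  apply: det_nondvd_perm => //; rewrite det_mulmx dvdzE abszM.
  by rewrite (@absz_unit (\det R)) ?mul1n // -unitmxE.
have le_cs i : (c (s i) <= e i)%N.
  have := congr1 (fun M : 'M_N => M i (s i)) key.
  rewrite mul_mx_diag DE mul_diag_mx !mxE de => E.
  have : (p ^ c (s i) %| p ^ e i * `|(R *m X) i (s i)|)%N.
    by rewrite -[X in (_ %| X * _)%N]absz_nat -abszM mxE E abszM absz_nat dvdn_mull.
  rewrite Gauss_dvdl ?dvdn_Pexp2l ?prime_gt1 //.
  by rewrite coprimeXl // prime_coprime //; apply: hs.
have eqcs i : e i = c (s i).
  apply/eqP; rewrite eqn_leq le_cs andbT leqNgt; apply/negP => lti.
  have : (\sum_i c (s i) < \sum_i e i)%N.
    rewrite (bigD1 i) //= [X in (_ < X)%N](bigD1 i) //= -addSn leq_add //.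
    by apply: leq_sum => j _.
  by rewrite sume [X in (_ < X)%N](reindex_inj (@perm_inj _ s)) ltnn.
exists (L *m S), R, d; split => //.
  split; first by rewrite size_map size_iota.
    rewrite /d; apply/(sortedP 0) => i; rewrite size_map size_iota => hi.
    rewrite !(nth_map 0%N) ?size_iota ?nth_iota ?add0n ?(ltnW hi) //.
    change (a i %| a i.+1)%N.
    have [lt|ge] := ltnP i.+1 (size d0); first by move/(sortedP 0): sd0; apply.
    by rewrite {2}/a (nth_default 0 ge) dvdn0.
  by apply/allP => x /mapP[i _ ->].
have -> : d = [seq (p ^ c (s i))%:Z | i : 'I_N].
  rewrite /image_mem -[enum_mem _]/(enum _); apply: (@eq_from_nth _ 0).
    by rewrite !size_map size_iota -enumT size_enum_ord.
  rewrite size_map size_iota => i hi.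
  rewrite (nth_map (Ordinal hi)) -?enumT ?size_enum_ord //.
  by rewrite -eqcs -de (nth_ord_enum _ (Ordinal hi)).
rewrite [X in perm_eq X _](_ : _ = map (fun i => (p ^ c i)%:Z) (map s (enum 'I_N))).
  apply: perm_map; apply: uniq_perm.
  - by rewrite map_inj_uniq ?enum_uniq //; apply: perm_inj.
  - exact: enum_uniq.
  move=> i; rewrite mem_enum inE; apply/mapP; exists ((s^-1)%g i).
    by rewrite mem_enum.
  by rewrite permKV.
by rewrite -map_comp.
Qed.

(** * Counting partitions *)

Section PartitionCounting.
Local Open Scope nat_scope.

Lemma count_mem_perm (s t : seq nat) :
  (forall x, count_mem x s = count_mem x t) -> perm_eq s t.
Proof. by move=> st; apply/allP => x _; apply/eqP/st. Qed.

Lemma intpartP d (l : 'P_d) :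
  [/\ sorted geq l, 0 \notin parts l & sumn l = d].
Proof. by case: l => l /= /andP[/andP[-> ->] /eqP ->]. Qed.

Lemma intpart_perm d (l m : 'P_d) : perm_eq l m -> l = m.
Proof.
move=> lm; apply: val_inj; apply: (@sorted_eq _ geq) => //.
- by move=> a b c /= ba cb; apply: leq_trans cb ba.
- by move=> a b /= /andP[ba ab]; apply/eqP; rewrite eqn_leq ba ab.
- by case: (intpartP l).
- by case: (intpartP m).
Qed.

Lemma sumn_perm (s t : seq nat) : perm_eq s t -> sumn s = sumn t.
Proof. by move=> st; rewrite !sumnE; apply: perm_big. Qed.

Fact part_of_subproof d (s : seq nat) : 0 \notin s -> sumn s = d ->
  is_part (sort geq s) && (sumn (sort geq s) == d).
Proof.
move=> s0 <-; rewrite /is_part mem_sort s0 andbT.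
rewrite sort_sorted /=; last by move=> a b; apply: leq_total.
by apply/eqP/sumn_perm; rewrite perm_sort.
Qed.
Definition part_of d s (s0 : 0 \notin s) (sd : sumn s = d) : 'P_d :=
  IntPart (part_of_subproof s0 sd).

Lemma perm_part_of d s (s0 : 0 \notin s) (sd : sumn s = d) :
  perm_eq (part_of s0 sd) s.
Proof. by rewrite /= perm_sort. Qed.

Lemma count_part_le d (l : 'P_d) k : count_mem k l <= d.
Proof.
have [_ l0 ld] := intpartP l; rewrite -[X in _ <= X]ld.
by apply: leq_trans (count_size _ _) (size_le_sumn l0).
Qed.

Lemma count_part_gt d (l : 'P_d) k : d < k -> count_mem k l = 0.
Proof.
move=> dk; apply/count_memPn; apply/negP => /mem_le_sumn.
by have [_ _ ->] := intpartP l; rewrite leqNgt dk.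
Qed.

(** Removing j copies of k is a bijection onto the partitions of d - k j. *)
Lemma card_count_ge d k j : 0 < k ->
  #|[set l : 'P_d | j <= count_mem k l]| =
    if k * j <= d then #|{: 'P_(d - k * j)}| else 0.
Proof.
move=> k0; case: ifP => kj; last first.
  apply: eq_card0 => l; rewrite !inE; apply/negP => jl.
  have [_ _ ld] := intpartP l; case/negP: kj; rewrite -[X in _ <= X]ld.
  have /sumn_perm <- :
      perm_eq ([seq x <- l | pred1 k x] ++ [seq x <- l | predC (pred1 k) x]) l.
    by apply/permPl/perm_filterC.
  rewrite sumn_cat; apply: leq_trans (leq_addr _ _).
  have /all_pred1P -> : all (pred1 k) [seq x <- l | pred1 k x] by exact: filter_all.
  by rewrite size_filter sumn_nseq leq_mul2l jl orbT.
have f0 (m : 'P_(d - k * j)) : 0 \notin nseq j k ++ m.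
  by rewrite mem_cat mem_nseq negb_or; have [_ -> _] := intpartP m; lia.
have fd (m : 'P_(d - k * j)) : sumn (nseq j k ++ m) = d.
  by rewrite sumn_cat sumn_nseq; have [_ _ ->] := intpartP m; rewrite subnKC.
pose f m := part_of (f0 m) (fd m).
have f_inj : injective f.
  move=> m m' /(congr1 val) /= /(congr1 (fun s => perm_eq s (nseq j k ++ m))).
  rewrite perm_sort perm_refl => /esym; rewrite perm_sort perm_cat2l => h.
  by apply/esym/intpart_perm.
rewrite -(card_imset _ f_inj); apply: eq_card => l; rewrite inE.
apply/idP/imsetP => [jl|[m _ ->]]; last first.
  rewrite (seq.permP (perm_part_of (f0 m) (fd m))) count_cat count_nseq /= eqxx mul1n.
  exact: leq_addr.
pose s := nseq (count_mem k l - j) k ++ [seq x <- l | x != k].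
have ls : perm_eq l (nseq j k ++ s).
  apply: count_mem_perm => x; rewrite !count_cat !count_nseq count_filter /=.
  have [->|xk] := eqVneq x k.
    rewrite ?eqxx !mul1n addnA subnKC // [X in _ = _ + X](_ : _ = 0) ?addn0 //.
    by rewrite -(count_pred0 l); apply: eq_count => y /=; case: eqP.
  rewrite ?(eq_sym k) ?(negPf xk) !mul0n !add0n; apply: eq_count => y /=.
  by case: eqP => // ->; rewrite xk.
have [_ l0 ld] := intpartP l.
have s0 : 0 \notin s.
  by apply: contra l0 => s0; rewrite (perm_mem ls) mem_cat s0 orbT.
have sd : sumn s = d - k * j.
  by rewrite -ld (sumn_perm ls) sumn_cat sumn_nseq addKn.
exists (part_of s0 sd) => //; apply: intpart_perm; apply: (perm_trans ls).
rewrite perm_sym; apply: (perm_trans (perm_part_of _ _)).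
by rewrite perm_cat2l; apply: perm_part_of.
Qed.

Lemma sum_nat_bool_interval N lo hi : lo <= hi ->
  \sum_(1 <= a < N.+1) (lo < a <= hi) = minn hi N - minn lo N.
Proof.
move=> lohi; elim: N => [|N IH]; first by rewrite big_nil; lia.
by rewrite big_nat_recr //= IH; lia.
Qed.

Lemma sum_nat_eq N n0 (F : nat -> nat) :
  \sum_(1 <= n < N.+1) (n == n0) * F n = if 0 < n0 <= N then F n0 else 0.
Proof.
case: ifP => h; last first.
  rewrite big_nat big1 // => n hn; case: eqP hn => // ->.
  by rewrite ltnS h.
rewrite (bigD1_seq n0) ?mem_index_iota ?iota_uniq //= eqxx mul1n big1 ?addn0 //.
by move=> n /negPf ->.
Qed.

Lemma divn_sum_nat m q d : 0 < q -> m <= d ->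
  m %/ q = \sum_(1 <= j < d.+1) (j * q <= m).
Proof.
move=> q0 md; have := @sum_nat_bool_interval d 0 (m %/ q) isT.
have -> : minn (m %/ q) d - minn 0 d = m %/ q.
  by rewrite min0n subn0; apply/minn_idPl/(leq_trans (leq_div _ _) md).
move=> <-; apply: eq_big_nat => j /andP[j1 _].
by rewrite j1 /= leq_divRL.
Qed.

(** Both sides count the pairs of a partition and j > 0, with at least q j parts
    equal to k on the left, and at least j parts equal to k q on the right; the
    number of partitions of d with at least a parts b only depends on a b. *)
Lemma sum_count_div d k q : 0 < k -> 0 < q ->
  \sum_(l : 'P_d) count_mem k l %/ q = \sum_(l : 'P_d) count_mem (k * q) l.
Proof.
move=> k0 q0.
have E k' q' : 0 < k' -> 0 < q' -> \sum_(l : 'P_d) count_mem k' l %/ q' =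
    \sum_(1 <= j < d.+1) if k' * q' * j <= d then #|{: 'P_(d - k' * q' * j)}| else 0.
  move=> k'0 q'0; under [LHS]eq_bigr => l _ do rewrite (divn_sum_nat q'0 (count_part_le l k')).
  rewrite exchange_big /=; apply: eq_bigr => j _.
  rewrite -mulnA (mulnC q') -card_count_ge // -sum1dep_card [RHS]big_mkcond /=.
  by apply: eq_bigr => l _; case: (j * q' <= _).
rewrite E //.
under [RHS]eq_bigr => l _ do rewrite -[count_mem _ _]divn1.
by rewrite E ?muln_gt0 ?k0 // muln1.
Qed.

Lemma size_count_sum d (l : 'P_d) :
  size l = \sum_(1 <= k < d.+1) count_mem k l.
Proof.
have [_ l0 ld] := intpartP l.
have : all (fun k => 0 < k <= d) l.
  apply/allP => k kl; rewrite -ld (mem_le_sumn kl) andbT lt0n.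
  by apply: contraNneq l0 => <-.
elim: (parts l) => [_|k s IH] /=; first by rewrite big1.
move=> /andP[hk /IH ->]; rewrite big_split /= -add1n; congr (_ + _).
transitivity (\sum_(1 <= n < d.+1) (n == k) * 1); first by rewrite sum_nat_eq hk.
by apply: eq_bigr => n _; rewrite muln1 eq_sym.
Qed.

(** The exponent of p that m parts equal to k contribute to D_r. *)
Definition part_exponent (p r k m : nat) : nat :=
  if logn p k < r then (r - logn p k) * m + dp p m else 0.

Lemma logn_expM p i n : prime p -> 0 < n -> logn p (p ^ i * n) = i + logn p n.
Proof.
by move=> pp n0; rewrite lognM ?pfactorK // expn_gt0 prime_gt0.
Qed.

Lemma dp_widen p m d : m <= d -> 1 < p ->
  dp p m = \sum_(1 <= j < d.+1) m %/ p ^ j.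
Proof.
move=> md p1; rewrite /dp [RHS](@big_cat_nat _ _ _ m.+1) //=.
rewrite [X in _ = _ + X]big_nat [X in _ = _ + X]big1 ?addn0 // => j /andP[mj _].
by rewrite divn_small //; apply: ltn_trans mj _; apply: ltn_expl.
Qed.

(** A part k is p ^ i * n for a single n prime to p, and i is then the valuation of
    k: the double product runs over the parts of valuation less than r. *)
Lemma Dpart_exponent p r d (l : 'P_d) : prime p ->
  Dpart p r l = p ^ \sum_(1 <= k < d.+1) part_exponent p r k (count_mem k l).
Proof.
move=> pp; have [_ _ ld] := intpartP l; rewrite /Dpart ld.
under eq_bigr => n _ do rewrite -expn_sum.
rewrite -expn_sum; congr (_ ^ _).
pose g k := part_exponent p r k (count_mem k l).
have gE n i : 0 < n -> coprime n p -> i < r ->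
    (r - i) * count_mem (p ^ i * n) l + dp p (count_mem (p ^ i * n) l) =
    \sum_(1 <= k < d.+1) (k == p ^ i * n) * g k.
  move=> n0 cn ir; rewrite sum_nat_eq muln_gt0 expn_gt0 prime_gt0 //= n0 /=.
  have vi : logn p (p ^ i * n) = i.
    by rewrite logn_expM // logn_coprime ?addn0 // coprime_sym.
  case: leqP => h; first by rewrite /g /part_exponent vi ir.
  by rewrite count_part_gt // /dp big_geq // muln0.
transitivity (\sum_(1 <= n < d.+1 | coprime n p) \sum_(0 <= i < r)
    \sum_(1 <= k < d.+1) (k == p ^ i * n) * g k).
  rewrite big_nat_cond [RHS]big_nat_cond.
  apply: eq_bigr => n /andP[/andP[n0 _] cn].
  by apply: eq_big_nat => i /andP[_ ir]; apply: gE.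
under eq_bigr => n _ do rewrite exchange_big /=.
rewrite exchange_big /=; apply: eq_big_nat => k /andP[k0 kd].
under eq_bigr => n _ do rewrite -big_distrl /=.
rewrite -big_distrl /= -[RHS]mul1n -/(g k).
have [vr|vr] := ltnP (logn p k) r; last first.
  by rewrite (_ : g k = 0) ?muln0 // /g /part_exponent ltnNge vr.
congr (_ * _); rewrite exchange_big /=.
have k0' := k0.
have [n pn kE] := pfactor_coprime pp k0.
transitivity (\sum_(0 <= i < r) (i == logn p k : nat)).
  apply: eq_big_nat => i ir; rewrite big_mkcond /=.
  transitivity (\sum_(1 <= m < d.+1) (m == n) * (i == logn p k)).
    apply: eq_big_nat => m /andP[m0 _]; case: ifP => cm; last first.
      by case: eqP => // mn; move: cm; rewrite mn coprime_sym pn.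
    case: eqP => [kE'|nE].
      have vi : logn p k = i.
        by rewrite kE' logn_expM // logn_coprime ?addn0 // coprime_sym.
      rewrite vi eqxx; move: kE'; rewrite kE vi mulnC => /eqP.
      by rewrite eqn_pmul2l ?expn_gt0 ?prime_gt0 // eq_sym => ->.
    case: eqP => // mn; case: eqP => // iv; case: nE.
    by rewrite mn iv mulnC.
  rewrite sum_nat_eq; case: ifP => // /negP[].
  have n0 : 0 < n by move: k0; rewrite kE muln_gt0 => /andP[].
  rewrite n0 /=; apply: leq_trans (kd : k <= d).
  by rewrite kE leq_pmulr // expn_gt0 prime_gt0.
rewrite (bigD1_seq (logn p k)) ?mem_index_iota ?iota_uniq //= eqxx.
by rewrite big1 // => i /negPf ->.
Qed.

(** Let M_k be the number of parts k in all the partitions of d. The factorials of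
    the multiplicities of k contribute M_(kp) + M_(kp^2) + ... in total. So M_k gets
    r - v from itself if its valuation v is less than r, and 1 from each of its
    divisors k / p, ..., k / p ^ v of valuation less than r, which adds up to r. *)
Lemma sum_part_exponent p r d : prime p ->
  \sum_(l : 'P_d) \sum_(1 <= k < d.+1) part_exponent p r k (count_mem k l) =
  r * \sum_(l : 'P_d) size l.
Proof.
move=> pp; pose M k := \sum_(l : 'P_d) count_mem k l.
have M0 k : d < k -> M k = 0.
  by move=> dk; rewrite /M big1 // => l _; rewrite count_part_gt.
transitivity (\sum_(1 <= k < d.+1) (logn p k < r) *
    ((r - logn p k) * M k + \sum_(1 <= a < d.+1) M (k * p ^ a))).
  rewrite exchange_big /=; apply: eq_big_nat => k /andP[k0 _].
  rewrite /part_exponent; case: (ltnP (logn p k) r) => vr; last by rewrite big1.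
  rewrite mul1n big_split /= -big_distrr /=; congr (_ + _).
  under eq_bigr => l _ do rewrite (dp_widen (count_part_le l k) (prime_gt1 pp)).
  rewrite exchange_big /=; apply: eq_big_nat => a _.
  by rewrite sum_count_div // expn_gt0 prime_gt0.
have -> : \sum_(l : 'P_d) size l = \sum_(1 <= k < d.+1) M k.
  under [LHS]eq_bigr => l _ do rewrite size_count_sum.
  by rewrite exchange_big.
under eq_bigr => k _ do rewrite mulnDr.
rewrite big_split /=.
have -> : \sum_(1 <= k < d.+1) (logn p k < r) * \sum_(1 <= a < d.+1) M (k * p ^ a) =
          \sum_(1 <= K < d.+1) minn (logn p K) r * M K.
  transitivity (\sum_(1 <= k < d.+1) \sum_(1 <= a < d.+1) \sum_(1 <= K < d.+1)
       (K == k * p ^ a) * ((logn p k < r) * M K)).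
    apply: eq_big_nat => k /andP[k0 kd]; rewrite big_distrr /=.
    apply: eq_big_nat => a _; rewrite sum_nat_eq muln_gt0 expn_gt0 k0 prime_gt0 //=.
    by case: (leqP _ d) => // h; rewrite (M0 _ h) muln0.
  under eq_bigr => k _ do rewrite exchange_big /=.
  rewrite exchange_big /=; apply: eq_big_nat => K /andP[K0 Kd].
  under eq_bigr => k _ do under eq_bigr => a _ do rewrite mulnA.
  under eq_bigr => k _ do rewrite -big_distrl /=.
  rewrite -big_distrl /=; congr (_ * _); rewrite exchange_big /=.
  set v := logn p K.
  have vd : v <= d by apply: leq_trans (ltnW (ltn_logl _ K0)) (ltnSE Kd).
  have := @sum_nat_bool_interval d (v - r) v (leq_subr _ _).
  have -> : minn v d - minn (v - r) d = minn v r by lia.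
  move=> <-; apply: eq_big_nat => a /andP[a0 _].
  have [n pn KE] := pfactor_coprime pp K0; rewrite -/v in KE.
  transitivity (\sum_(1 <= k < d.+1) (k == n * p ^ (v - a)) * (v - r < a <= v)).
    apply: eq_big_nat => k /andP[k0 _].
    case: eqP => [Kk|nKk].
      have vk : v = logn p k + a.
        by rewrite /v Kk mulnC logn_expM // addnC.
      have -> : k == n * p ^ (v - a).
        move: Kk; rewrite KE vk addnK expnD mulnA => /eqP.
        by rewrite eqn_pmul2r ?expn_gt0 ?prime_gt0 // eq_sym.
      lia.
    case: eqP => // kE; rewrite mul0n mul1n.
    case: (leqP a v) => av; rewrite ?andbF // andbT; case: nKk.
    by rewrite kE -mulnA -expnD subnK.
  have n0 : 0 < n by move: K0; rewrite KE muln_gt0 => /andP[].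
  rewrite sum_nat_eq; case: ifP => // /negP[].
  rewrite muln_gt0 n0 expn_gt0 prime_gt0 //=; apply: leq_trans (Kd : K <= d).
  by rewrite KE leq_mul2l leq_exp2l ?prime_gt1 // leq_subr orbT.
rewrite -big_split big_distrr /=; apply: eq_big_nat => k _.
rewrite mulnA -mulnDl; congr (_ * _).
by case: ltnP; lia.
Qed.

End PartitionCounting.

(** * Truncated power series and Newton's identities *)

Section TruncatedSeries.
Variable A : comNzRingType.
Implicit Types (f g h : {poly A}) (N : nat).

(** Congruence modulo t ^ (N + 1). *)
Definition eqX N f g := forall k, (k <= N)%N -> f`_k = g`_k.

Lemma eqX_sym N f g : eqX N f g -> eqX N g f.
Proof. by move=> fg k /fg. Qed.

Lemma eqX_trans N f g h : eqX N f g -> eqX N g h -> eqX N f h.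
Proof. by move=> fg gh k kN; rewrite fg ?gh. Qed.

Lemma eqX_add N f g f' g' : eqX N f g -> eqX N f' g' -> eqX N (f + f') (g + g').
Proof. by move=> fg fg' k kN; rewrite !coefD fg ?fg'. Qed.

Lemma eqX_mul N f g f' g' : eqX N f g -> eqX N f' g' -> eqX N (f * f') (g * g').
Proof.
move=> fg fg' k kN; rewrite !coefM; apply: eq_bigr => i _.
by rewrite fg ?fg' //; have := ltn_ord i; lia.
Qed.

(** The Euler operator t d/dt. *)
Definition euler f := 'X * f^`().

Lemma coef_euler f k : (euler f)`_k = f`_k *+ k.
Proof. by rewrite coefXM; case: k => [|k] /=; rewrite ?coef_deriv. Qed.

Lemma eulerM f g : euler (f * g) = euler f * g + f * euler g.
Proof. by rewrite /euler derivM; ring. Qed.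

Definition psum_series (p : nat -> A) N : {poly A} :=
  \poly_(j < N.+1) (if j is 0 then 0 else p j).

(** Newton's identities: the logarithmic derivative of a product is a sum. *)
Lemma euler_prod n (x : 'I_n -> A) N :
  eqX N (euler (\prod_i (1 - x i *: 'X)))
        (- psum_series (fun j => \sum_i x i ^+ j) N * \prod_i (1 - x i *: 'X)).
Proof.
have -> : psum_series (fun j => \sum_i x i ^+ j) N =
          \sum_i psum_series (fun j => x i ^+ j) N.
  apply/polyP => k; rewrite /psum_series coef_sum !coef_poly.
  under [RHS]eq_bigr => i _ do rewrite coef_poly.
  by case: (k < N.+1)%N; [case: k => [|k] // | ]; rewrite big1.
elim: (index_enum _) => [|i r IH].
  rewrite !big_nil oppr0 mul0r => k _.
  by rewrite coef_euler coef0 coef1; case: k => [|k]; rewrite ?mulr0n ?mul0rn.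
rewrite !big_cons; set q := \prod_(j <- r) _; rewrite -/q in IH.
rewrite eulerM opprD [X in eqX _ _ X]mulrDl; apply: eqX_add; last first.
  by rewrite [X in eqX _ _ X]mulrCA; apply: eqX_mul.
rewrite [X in eqX _ _ X]mulrA; apply: eqX_mul => // k kN.
rewrite coef_euler coefB coef1 coefZ coefX mulrBr mulr1 -scalerAr coefB coefZ coefMX.
rewrite !coefN /psum_series !coef_poly ltnS kN.
case: k kN => [|[|k]] kN /=; first by rewrite mulr0n oppr0 mulr0 subr0.
  by rewrite !mulr1 mulr1n oppr0 mulr0 subr0 sub0r expr1.
by rewrite mulr0 subr0 mul0rn ltnS ltnW // exprS mulrN opprK addNr.
Qed.

(** The sequence with u_0 = 1 and u_k = c_k (b_1 u_(k-1) + ... + b_k u_0), which needs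
    all the previous terms: they are kept in a list, the latest one first. *)
Fixpoint recurrent_rev (c b : nat -> A) k : seq A :=
  if k is k'.+1 then
    c k * (\sum_(j < k) b j.+1 * (recurrent_rev c b k')`_j) :: recurrent_rev c b k'
  else [:: 1].

Definition recurrent c b k : A := (recurrent_rev c b k)`_0.

Lemma recurrent0 c b : recurrent c b 0 = 1.
Proof. by []. Qed.

Lemma recurrentS c b k :
  recurrent c b k.+1 = c k.+1 * \sum_(j < k.+1) b j.+1 * recurrent c b (k - j).
Proof.
have nthr m j : (j <= m)%N -> (recurrent_rev c b m)`_j = recurrent c b (m - j).
  by elim: m j => [|m IH] [|j] //= jm; rewrite IH.
congr (_ * _); apply: eq_bigr => j _; congr (_ * _).
by rewrite nthr // -ltnS.
Qed.

End TruncatedSeries.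

Lemma coef_prod_mesym (R : comNzRingType) n k :
  (\prod_(i < n) (1 - 'X_i *: 'X) : {poly {mpoly R[n]}})`_k = (-1) ^+ k * mesym n R k.
Proof.
under eq_bigr => i _ do rewrite addrC.
rewrite bigA_distr coef_sum /mesym big_distrr [RHS]big_mkcond /=.
apply: eq_bigr => J _; rewrite -big_mkcond /=.
rewrite (eq_bigr (fun i => (- 'X_i)%:P * 'X)); last first.
  by move=> i _; rewrite mul_polyC scaleNr.
rewrite big_split /= prodr_const -rmorph_prod /= coefCM coefXn prodrN.
rewrite eq_sym; case: eqP => [->|_]; first by rewrite mulr1.
by rewrite mulr0.
Qed.

Section NewtonRelations.
Variable A : comNzRingType.

(** The relation t E' = - P E between the generating series E of e and P of p. *)
Definition newton (e p : nat -> A) :=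
  forall k, e k *+ k = - \sum_(j < k) p j.+1 * e (k.-1 - j)%N.

Lemma coef_psum_series_mul p (f : {poly A}) N k : (k <= N)%N ->
  (psum_series p N * f)`_k = \sum_(j < k) p j.+1 * f`_(k.-1 - j).
Proof.
move=> kN; rewrite coefM big_ord_recl /= coef_poly mul0r add0r.
case: k kN => [|k] kN; first by rewrite !big_ord0.
apply: eq_bigr => j _; rewrite /psum_series coef_poly /= /bump ifT;
  last by have := ltn_ord j; lia.
by congr (_ * _`_ _); lia.
Qed.

(** Since E H = 1, the relation t E' = - P E gives 0 = t (E H)' = E (t H' - P H), and
    E is invertible. *)
Lemma newton_inverse (e p : nat -> A) : e 0 = 1 -> newton e p ->
  forall k, let h := recurrent (fun=> -1) e in
  h k *+ k = \sum_(j < k) p j.+1 * h (k.-1 - j)%N.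
Proof.
move=> e0 eP N h.
pose E := \poly_(k < N.+1) e k; pose H := \poly_(k < N.+1) h k.
pose P := psum_series p N.
have EH : eqX N (E * H) 1.
  case=> [|k] kN; rewrite coefM coef1 /=.
    by rewrite big_ord_recl big_ord0 !coef_poly /= e0 mulr1 addr0.
  rewrite big_ord_recl /= !coef_poly /= ltnS kN e0 mul1r subn0 /h recurrentS.
  rewrite mulN1r addrC; apply/eqP; rewrite subr_eq0; apply/eqP.
  apply: eq_bigr => j _; rewrite !coef_poly /bump /= add1n subSS.
  by rewrite !ifT //; have := ltn_ord j; lia.
have EE : eqX N (euler E) (- P * E).
  move=> k kN; rewrite coef_euler mulNr coefN coef_psum_series_mul // coef_poly.
  rewrite ltnS kN eP; congr (- _); apply: eq_bigr => j _.
  by rewrite coef_poly ifT //; have := ltn_ord j; lia.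
have EuH : eqX N (euler H) (P * H).
  suff : eqX N (H * (E * (euler H - P * H))) 0.
    move=> h0 k kN; apply/eqP; rewrite -subr_eq0 -coefB; apply/eqP.
    rewrite -[RHS](coef0 _ k) -(h0 k kN) -[in LHS](mul1r (_ - _)) mulrA.
    by apply: (@eqX_mul _ N) => // i iN; rewrite mulrC EH.
  have : eqX N (euler (E * H)) 0.
    move=> k kN; rewrite coef_euler EH // coef0 coef1.
    by case: k {kN} => [|k]; rewrite ?mulr0n ?mul0rn.
  rewrite eulerM => h0; rewrite -[0](mulr0 H); apply: eqX_mul => //.
  apply: eqX_trans h0; rewrite mulrBr addrC mulrA [E * P]mulrC -mulNr -mulNr.
  by apply: eqX_add => //; apply: eqX_mul => //; apply: eqX_sym.
have := EuH N (leqnn N); rewrite coef_euler coef_psum_series_mul // coef_poly ltnSn => ->.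
by apply: eq_bigr => j _; rewrite coef_poly ifT //; lia.
Qed.

End NewtonRelations.

Lemma rmorph_recurrent (A B : comNzRingType) (f : {rmorphism A -> B}) c b k :
  f (recurrent c b k) = recurrent (f \o c) (f \o b) k.
Proof.
elim/ltn_ind: k => -[|k] IH; first by rewrite rmorph1.
rewrite !recurrentS rmorphM rmorph_sum /=; congr (_ * _).
by apply: eq_bigr => j _; rewrite rmorphM /= IH // ltnS leq_subr.
Qed.

Lemma eq_recurrent (A : comNzRingType) (c b b' : nat -> A) :
  b =1 b' -> recurrent c b =1 recurrent c b'.
Proof.
move=> bb'; elim/ltn_ind => -[|k] IH //; rewrite !recurrentS.
by congr (_ * _); apply: eq_bigr => j _; rewrite bb' IH // ltnS leq_subr.
Qed.

(** * Restriction of symmetric functions to finitely many variables *)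

Section Symfun.
Variable R : comNzRingType.
Implicit Types f g : symfun R.

Definition at_vars n f : {mpoly R[n]} := symfun_val f n.

Lemma at_vars_sub n : {morph at_vars n : f g / f - g}.
Proof.
by move=> f g; apply: (congr1 (@^~ n) (raddfB (val : symfun R -> polyfam R) f g)).
Qed.
Lemma at_vars_mul n : multiplicative (at_vars n).
Proof.
split=> [f g|]; first exact: (congr1 (@^~ n) (rmorphM (val : symfun R -> polyfam R) f g)).
exact: (congr1 (@^~ n) (rmorph1 (val : symfun R -> polyfam R))).
Qed.
Lemma at_vars_scale n : scalable (at_vars n).
Proof.
by move=> a f; apply: (congr1 (@^~ n) (linearZZ (val : symfun R -> polyfam R) a f)).
Qed.
HB.instance Definition _ n :=
  GRing.isAdditive.Build (symfun R) {mpoly R[n]} (at_vars n) (at_vars_sub n).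
HB.instance Definition _ n :=
  GRing.isMultiplicative.Build (symfun R) {mpoly R[n]} (at_vars n) (at_vars_mul n).
HB.instance Definition _ n :=
  GRing.isScalable.Build R (symfun R) {mpoly R[n]} _ (at_vars n) (at_vars_scale n).

Lemma symfunP f g : (forall n, at_vars n f = at_vars n g) -> f = g.
Proof. by move=> fg; apply/val_inj/polyfamP. Qed.

Lemma at_vars_sym n f : at_vars n f \is symmetric.
Proof. by rewrite /at_vars; case: f => f /= /asboolP[]. Qed.

Lemma drop_at_vars n f : drop_last_var (at_vars n.+1 f) = at_vars n f.
Proof. by rewrite /at_vars; case: f => f /= /asboolP[]. Qed.

Lemma in_degreeM d e f g : in_degree d f -> in_degree e g -> in_degree (d + e) (f * g).
Proof.
move=> df eg n; rewrite -/(at_vars n _) rmorphM.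
by apply: dhomogM; [apply: df | apply: eg].
Qed.

Lemma in_degreeX d f k : in_degree d f -> in_degree (d * k) (f ^+ k).
Proof. by move=> df n; rewrite -/(at_vars n _) rmorphXn; apply: dhomogMn; apply: df. Qed.

Lemma in_degreeB d f g : in_degree d f -> in_degree d g -> in_degree d (f - g).
Proof.
move=> df dg n; rewrite -/(at_vars n _) raddfB.
by apply: rpredB; [apply: df | apply: dg].
Qed.

Lemma in_degreeZ d a f : in_degree d f -> in_degree d (a *: f).
Proof. by move=> df n; rewrite -/(at_vars n _) linearZ; apply: rpredZ; apply: df. Qed.

Lemma in_degree_sum d I r (P : pred I) (F : I -> symfun R) :
  (forall i, P i -> in_degree d (F i)) -> in_degree d (\sum_(i <- r | P i) F i).
Proof.
by move=> dF n; rewrite -/(at_vars n _) raddf_sum rpred_sum // => i /dF /(_ n).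
Qed.

Lemma in_degree0_1 : in_degree 0 (1 : symfun R).
Proof. by move=> n; rewrite -/(at_vars n _) rmorph1 dhomog1. Qed.

Lemma in_degree_prod (s : seq nat) (g : nat -> symfun R) :
  (forall k, (0 < k)%N -> in_degree k (g k)) -> 0%N \notin s ->
  in_degree (sumn s) (\prod_(k <- s) g k).
Proof.
move=> dg; elim: s => [_|k s IH]; first by rewrite big_nil; apply: in_degree0_1.
rewrite in_cons negb_or => /andP[k0 /IH s0].
by rewrite big_cons; apply: in_degreeM => //; apply: dg; rewrite lt0n eq_sym.
Qed.

End Symfun.
Arguments at_vars : simpl never.

Lemma comp_mpoly_comp (R : comNzRingType) n m l (p : {mpoly R[n]})
    (u : n.-tuple {mpoly R[m]}) (v : m.-tuple {mpoly R[l]}) :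
  (p \mPo u) \mPo v = p \mPo [tuple tnth u i \mPo v | i < n].
Proof.
elim/mpolyind: p => [|c a p _ _ IH]; first by rewrite !raddf0.
rewrite !raddfD /= IH; congr (_ + _).
rewrite !comp_mpolyZ !comp_mpolyX rmorph_prod /=; congr (_ *: _).
by apply: eq_bigr => i _; rewrite rmorphXn tnth_mktuple.
Qed.

Section DropLastVariable.
Variable R : comNzRingType.

Lemma drop_last_varX n (i : 'I_n.+1) :
  drop_last_var ('X_i : {mpoly R[n.+1]}) =
    if unlift ord_max i is Some j then 'X_j else 0.
Proof. by rewrite /drop_last_var comp_mpolyXU -tnth_nth tnth_mktuple. Qed.

Definition extend_mnm n (m : 'X_{1..n}) : 'X_{1..n.+1} :=
  [multinom (if unlift ord_max i is Some j then m j else 0%N) | i < n.+1].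

Lemma mcoeff_drop n (f : {mpoly R[n.+1]}) (m : 'X_{1..n}) :
  (drop_last_var f)@_m = f@_(extend_mnm m).
Proof.
have wl (i : 'I_n) : widen_ord (leqnSn n) i = lift ord_max i.
  by apply: val_inj; rewrite /= /bump leqNgt ltn_ord.
rewrite /drop_last_var; elim/mpolyind: f => [|c a f _ _ IH].
  by rewrite raddf0 !mcoeff0.
rewrite raddfD /= comp_mpolyZ !mcoeffD !mcoeffZ IH; congr (_ * _ + _).
rewrite comp_mpolyX big_ord_recr /= tnth_mktuple unlift_none.
under eq_bigr => i _ do rewrite tnth_mktuple wl liftK.
pose b := [multinom a (lift ord_max i) | i < n].
rewrite (_ : \prod_i _ = 'X_[b]); last first.
  by rewrite mpolyXE_id; apply: eq_bigr => i _; rewrite mnmE.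
rewrite mcoeffX.
case: (posnP (a ord_max)) => [a0|a_gt0].
  rewrite a0 expr0 mulr1 mcoeffX; congr ((_ : bool)%:R); apply/eqP/eqP => [<-|ae].
    apply/mnmP => i; rewrite mnmE.
    by case: unliftP => [j ->|->]; rewrite ?mnmE.
  by apply/mnmP => i; rewrite mnmE ae mnmE liftK.
rewrite expr0n eqn0Ngt a_gt0 mulr0 mcoeff0; case: eqP => // ae; move: a_gt0.
by rewrite ae mnmE unlift_none.
Qed.

(** In more than d variables every monomial of degree d misses a variable, which
    may be assumed to be the last one by symmetry. *)
Lemma sym_homog_drop_eq0 n d (f : {mpoly R[n.+1]}) : (d <= n)%N ->
  f \is symmetric -> f \is d.-homog -> drop_last_var f = 0 -> f = 0.
Proof.
move=> dn fsym fd f0; apply/mpolyP => m; rewrite mcoeff0.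
have [md|md] := eqVneq (mdeg m) d; last exact: dhomog_nemf_coeff fd md.
have [i mi] : exists i, m i = 0%N.
  suff /existsP[i /eqP mi] : [exists i, m i == 0%N] by exists i.
  apply: contraLR dn; rewrite negb_exists => /forallP m0.
  rewrite -ltnNge -md mdegE -[X in (X <= _)%N](card_ord n.+1) -sum1_card.
  by apply: leq_sum => j _; rewrite lt0n m0.
pose s := tperm i ord_max.
have <- : f@_[multinom m (s j) | j < n.+1] = f@_m.
  by rewrite -mcoeff_sym (issymP _ fsym).
pose m' := [multinom m (s (lift ord_max j)) | j < n].
have -> : [multinom m (s j) | j < n.+1] = extend_mnm m'.
  apply/mnmP => j; rewrite !mnmE; case: unliftP => [k ->|->]; rewrite ?mnmE //.
  by rewrite tpermR.
by rewrite -mcoeff_drop f0 mcoeff0.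
Qed.

(** From d variables one gets to fewer variables by setting the last one to 0, and
    to more variables by the previous lemma. *)
Lemma at_vars_inj d (f g : symfun R) :
  in_degree d f -> in_degree d g -> at_vars d f = at_vars d g -> f = g.
Proof.
move=> df dg fg; apply/eqP; rewrite -subr_eq0; apply/eqP; set u := f - g.
have du : in_degree d u by apply: in_degreeB.
have u0 : at_vars d u = 0 by rewrite raddfB /= fg subrr.
apply: symfunP => n; rewrite raddf0.
have [dn|/ltnW nd] := leqP d n.
  elim: n dn => [|n IH]; first by rewrite leqn0 => /eqP d0; move: u0; rewrite d0.
  rewrite leq_eqVlt => /orP[/eqP <- //|dn].
  apply: (@sym_homog_drop_eq0 n d) => //; first exact: at_vars_sym.
  by rewrite drop_at_vars IH.
rewrite -(subKn nd); elim: (d - n)%N => [|k IH]; first by rewrite subn0.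
have [kd|kd] := ltnP k d; last first.
  by have -> : (d - k.+1 = d - k)%N by lia.
move: IH; rewrite (_ : d - k = (d - k.+1).+1)%N; last by lia.
by move=> IH; rewrite -drop_at_vars IH; apply: raddf0.
Qed.

End DropLastVariable.

(** * Elementary and complete symmetric functions *)

Lemma msize_dhomog (R : comNzRingType) n d (p : {mpoly R[n]}) :
  p \is d.-homog -> (msize p <= d.+1)%N.
Proof.
move=> /dhomogP pd; rewrite msizeE big_tnth; apply/bigmax_leqP => i _.
by have /pd /= -> := mem_tnth i (in_tuple (msupp p)).
Qed.

HB.instance Definition _ (R : comNzRingType) n :=
  GRing.RMorphism.copy (@drop_last_var R n) (comp_mpoly _).

Section SignedElementary.
Variable R : comNzRingType.

Definition sesym_fam k : polyfam R :=
  fun n => (\prod_(i < n) (1 - 'X_i *: 'X) : {poly {mpoly R[n]}})`_k.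

Lemma sesym_fam_homog k n : sesym_fam k n \is k.-homog.
Proof.
rewrite /sesym_fam coef_prod_mesym -signr_odd mulr_sign.
by case: ifP => _; rewrite ?rpredN; apply: dhomog_mesym.
Qed.

Fact sesym_subproof k : sesym_fam k \in @symfun_pred R.
Proof.
apply/asboolP; split=> [n|n|].
- rewrite /sesym_fam coef_prod_mesym -signr_odd mulr_sign.
  by case: ifP => _; rewrite ?rpredN mesym_sym.
- rewrite /sesym_fam -coef_map rmorph_prod big_ord_recr /=; congr (nth 0 (polyseq _) k).
  rewrite -[RHS]mulr1; congr (_ * _).
    apply: eq_bigr => i _; rewrite rmorphB rmorph1 /= map_polyZ map_polyX /=.
    have -> : widen_ord (leqnSn n) i = lift ord_max i.
      by apply: val_inj; rewrite /= /bump leqNgt ltn_ord.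
    by rewrite drop_last_varX liftK.
  by rewrite rmorphB rmorph1 /= map_polyZ map_polyX /= drop_last_varX unlift_none scale0r subr0.
- by exists k.+1 => n; apply/msize_dhomog/sesym_fam_homog.
Qed.

(** The sign (-1) ^ k of the elementary symmetric function e_k is built in: this makes
    the generating series of the complete functions the inverse of this one. *)
Definition sesym k : symfun R := SymFun (sesym_subproof k).

Lemma at_vars_sesym n k :
  at_vars n (sesym k) = (\prod_(i < n) (1 - 'X_i *: 'X) : {poly {mpoly R[n]}})`_k.
Proof. by []. Qed.

Lemma in_degree_sesym k : in_degree k (sesym k).
Proof. exact: sesym_fam_homog. Qed.

Lemma at_vars_psum n k : (0 < k)%N -> at_vars n (psum R k) = \sum_(i < n) 'X_i ^+ k.
Proof. by case: k. Qed.

Lemma in_degree_psum k : (0 < k)%N -> in_degree k (psum R k).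
Proof.
move=> k0 n; rewrite -/(at_vars n _) at_vars_psum //; apply: rpred_sum => i _.
by rewrite mpolyXn dhomogX /= mdegMn mdeg1 mul1n.
Qed.

Lemma sesym0 : sesym 0 = 1.
Proof.
apply: symfunP => n.
by rewrite at_vars_sesym coef_prod_mesym mesym0E expr0 mulr1 rmorph1.
Qed.

Lemma newton_sesym : newton sesym (psum R).
Proof.
move=> k; apply: symfunP => n; rewrite raddfMn raddfN raddf_sum /=.
rewrite at_vars_sesym -coef_euler (euler_prod _ (leqnn k)) mulNr coefN.
by rewrite coef_psum_series_mul.
Qed.

(** The complete symmetric functions, from the inversion of the generating series of
    the signed elementary ones. *)
Definition complete : nat -> symfun R := recurrent (fun=> -1) sesym.

Lemma complete0 : complete 0 = 1. Proof. by []. Qed.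

Lemma completeS k : complete k.+1 = - \sum_(j < k.+1) sesym j.+1 * complete (k - j).
Proof. by rewrite /complete recurrentS mulN1r. Qed.

Lemma newton_complete k :
  complete k *+ k = \sum_(j < k) psum R j.+1 * complete (k.-1 - j)%N.
Proof. exact: newton_inverse sesym0 newton_sesym k. Qed.

Lemma sesymS k :
  sesym k.+1 = - complete k.+1 - \sum_(j < k) sesym j.+1 * complete (k - j).
Proof.
by rewrite completeS opprK big_ord_recr /= subnn complete0 mulr1 addrAC subrr add0r.
Qed.

End SignedElementary.

Section BaseChangeMorphism.
Variable C : numDomainType.

Local Notation bc := (@int_base_change C).

Lemma at_vars_base_change n f : at_vars n (bc f) = map_mpoly intr (at_vars n f).
Proof. by []. Qed.

Lemma base_change_sub : {morph bc : f g / f - g}.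
Proof. by move=> f g; apply: symfunP => n; rewrite raddfB /= !at_vars_base_change !raddfB. Qed.
Lemma base_change_mul : multiplicative bc.
Proof.
split=> [f g|]; apply: symfunP => n.
  by rewrite rmorphM /= !at_vars_base_change !rmorphM.
by rewrite at_vars_base_change !rmorph1.
Qed.
HB.instance Definition _ :=
  GRing.isAdditive.Build (symfun int) (symfun C) (@int_base_change C) base_change_sub.
HB.instance Definition _ :=
  GRing.isMultiplicative.Build (symfun int) (symfun C) (@int_base_change C) base_change_mul.

Lemma base_changeZ (a : int) f : bc (a *: f) = a%:~R *: bc f.
Proof. by rewrite scaler_int -raddfMz -scaler_int intz. Qed.

Lemma base_change_psum k : bc (psum int k) = psum C k.
Proof.
apply: symfunP => n; rewrite at_vars_base_change.
rewrite /at_vars /= /psum_fam raddf_sum /=; apply: eq_bigr => i _.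
by rewrite rmorphXn /= map_mpolyX.
Qed.

Lemma base_change_sesym k : bc (sesym int k) = sesym C k.
Proof.
apply: symfunP => n; rewrite at_vars_base_change !at_vars_sesym -coef_map rmorph_prod /=.
congr (nth 0 (polyseq _) k); apply: eq_bigr => i _.
by rewrite rmorphB rmorph1 /= map_polyZ map_polyX /= map_mpolyX.
Qed.

Lemma base_change_complete k : bc (complete int k) = complete C k.
Proof.
rewrite /complete rmorph_recurrent /=.
rewrite (_ : bc \o (fun=> -1) = (fun=> -1)); last first.
  by apply/funext => j /=; rewrite rmorphN1.
by apply: eq_recurrent => j /=; apply: base_change_sesym.
Qed.

End BaseChangeMorphism.

(** * Adams operations and repeated variables *)

(** An exponent q + 1 is positive, which makes the substitution x_i |-> x_i ^ (q + 1)
    compatible with setting a variable to 0. *)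

Section PowerSubstitution.
Variables (R : comNzRingType) (q : nat).
Local Notation p := q.+1.

Definition power_vars n : n.-tuple {mpoly R[n]} := [tuple 'X_i ^+ p | i < n].

Lemma comp_power_varsX n (m : 'X_{1..n}) :
  'X_[m] \mPo power_vars n = 'X_[m *+ p] :> {mpoly R[n]}.
Proof.
rewrite comp_mpolyX mpolyXE_id; apply: eq_bigr => i _.
by rewrite tnth_mktuple -exprM mulmnE mulnC.
Qed.

Lemma power_vars_homog n d (f : {mpoly R[n]}) :
  f \is d.-homog -> f \mPo power_vars n \is (d * p).-homog.
Proof.
move=> /dhomogP fd; rewrite comp_mpolyEX big_seq; apply: rpred_sum => m mf.
by apply: rpredZ; rewrite comp_power_varsX dhomogX /= mdegMn fd.
Qed.

Definition adams_fam (f : polyfam R) : polyfam R := fun n => f n \mPo power_vars n.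

Fact adams_subproof f : adams_fam (symfun_val f) \in @symfun_pred R.
Proof.
apply/asboolP; split=> [n|n|].
- apply: msym_comp_poly; first exact: at_vars_sym.
  move=> s; pose F (i : 'I_n) : {mpoly R[n]} := 'X_i ^+ p.
  have -> : tval (power_vars n) = map F (enum 'I_n) by [].
  rewrite [X in perm_eq _ X](_ : _ = map F (map s (enum 'I_n))).
    apply: perm_map; apply: uniq_perm.
    + exact: enum_uniq.
    + by rewrite map_inj_uniq ?enum_uniq //; apply: perm_inj.
    move=> i; rewrite mem_enum inE; apply/esym/mapP; exists ((s^-1)%g i).
      by rewrite mem_enum.
    by rewrite permKV.
  have -> : tval [tuple msym s ((map F (enum 'I_n))`_i) | i < n] =
            [seq msym s ((map F (enum 'I_n))`_i) | i : 'I_n <- enum 'I_n] by [].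
  rewrite -[RHS]map_comp; apply: eq_map => i /=.
  rewrite (nth_map i) ?size_enum_ord // nth_ord_enum /F rmorphXn /= msymX.
  congr ('X_[_] ^+ _).
  by apply/mnmP => j; rewrite !mnmE (can2_eq (permK s) (permKV s)) eq_sym.
- rewrite /adams_fam -[symfun_val f n]/(at_vars n f) -drop_at_vars.
  rewrite /drop_last_var !comp_mpoly_comp; congr (_ \mPo _).
  apply: eq_from_tnth => i; rewrite !tnth_mktuple rmorphXn /= comp_mpolyXU -tnth_nth.
  rewrite tnth_mktuple; case: unliftP => [j|] _; last by rewrite raddf0 expr0n.
  by rewrite comp_mpolyXU -tnth_nth tnth_mktuple.
- have [_ _ [k bk]] : is_symfun (symfun_val f) by case: f => f /= /asboolP.
  exists (k * p).+1 => n; rewrite /adams_fam comp_mpolyEX big_tnth.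
  apply: leq_trans (msize_sum _ _ _) _; apply/bigmax_leqP => i _.
  apply: leq_trans (msizeZ_le _ _) _; rewrite comp_power_varsX msizeX ltnS mdegMn.
  rewrite leq_mul2r; apply/orP; right; apply: leq_trans (bk n).
  by apply/ltnW/msize_mdeg_lt; apply: (mem_tnth i (in_tuple _)).
Qed.

(** The p-th Adams operation; for p prime it lifts the Frobenius. *)
Definition adams f : symfun R := SymFun (adams_subproof f).

Lemma at_vars_adams n f : at_vars n (adams f) = at_vars n f \mPo power_vars n.
Proof. by []. Qed.

Lemma in_degree_adams d f : in_degree d f -> in_degree (d * p) (adams f).
Proof. by move=> df n; apply: power_vars_homog; apply: df. Qed.

End PowerSubstitution.

Lemma fermat_little_int p (c : int) : prime p -> exists a, c ^+ p = c + a *+ p.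
Proof.
move=> pp; have p0 : p%:Z != 0 by case: p pp.
suff /dvdzP[a ca] : (p%:Z %| c ^+ p - c)%Z.
  by exists a; rewrite -mulr_natr natz -ca addrC subrK.
rewrite -eqz_mod_dvd -modzXm; have [a Ea] : exists a : nat, (c %% p)%Z = a%:Z.
  by exists `|(c %% p)%Z|%N; rewrite gez0_abs // modz_ge0.
have Pexp k : (a ^ k)%N%:Z = a%:Z ^+ k.
  by elim: k => // k IH; rewrite expnS PoszM IH exprS.
have aE : (a %% p)%N = a by apply/eqP; rewrite -eqz_nat -modz_nat -Ea modz_mod.
by rewrite Ea -Pexp modz_nat fermat_little // aE.
Qed.

(** It holds for monomials, for constants by Fermat's little theorem, and the binomial
    theorem extends it to sums. *)
Lemma frobenius_congruence q n (y : {mpoly int[n]}) : prime q.+1 ->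
  exists z, y ^+ q.+1 = y \mPo power_vars int q n + z *+ q.+1.
Proof.
move=> pp; set p := q.+1 in pp *.
elim/mpolyind: y => [|c m f _ _ [z IH]].
  by exists 0; rewrite raddf0 mul0rn addr0 expr0n.
have [a ca] := fermat_little_int c pp.
set u := c *: 'X_[m].
pose w := \sum_(1 <= i < p) (u ^+ (p - i) * f ^+ i) *+ ('C(p, i) %/ p).
exists (a *: 'X_[m *+ p] + z + w).
rewrite exprDn -(big_mkord xpredT (fun i => u ^+ (p - i) * f ^+ i *+ 'C(p, i))).
rewrite big_nat_recr //= big_ltn // subn0 subnn bin0 binn !mulr1n expr0 mulr1 mul1r.
have -> : \sum_(1 <= i < p) u ^+ (p - i) * f ^+ i *+ 'C(p, i) = w *+ p.
  rewrite -sumrMnl; apply: eq_big_nat => i hi; rewrite -mulrnA divnK //.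
  exact: prime_dvd_bin.
rewrite IH /u exprZn mpolyXn ca raddfD /= comp_mpolyZ comp_power_varsX.
rewrite !mulrnDl scalerDl scalerMnl; ring.
Qed.

Section RepeatedVariables.
Variables (R : comNzRingType) (s n : nat).

Definition repeat_vars : #|{: 'I_s * 'I_n}|.-tuple {mpoly R[n]} :=
  [tuple 'X_((enum_val i).2) | i < #|{: 'I_s * 'I_n}|].

(** Repeating each of the n variables s times multiplies the power sums by s: this
    is the value in n variables of the endomorphism Psi of the ring of symmetric
    functions that maps p_k to s p_k. *)
Definition repeated (f : symfun R) : {mpoly R[n]} :=
  at_vars #|{: 'I_s * 'I_n}| f \mPo repeat_vars.

HB.instance Definition _ :=
  GRing.LRMorphism.copy repeated (comp_mpoly repeat_vars \o at_vars _).

Lemma repeated_psum k : (0 < k)%N -> repeated (psum R k) = at_vars n (psum R k) *+ s.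
Proof.
move=> k0; rewrite /repeated !at_vars_psum // raddf_sum /=.
under eq_bigr => i _ do rewrite rmorphXn /= comp_mpolyXU -tnth_nth tnth_mktuple.
rewrite (reindex (@enum_rank {: 'I_s * 'I_n})) /=; last first.
  by exists enum_val => i _; rewrite ?enum_rankK ?enum_valK.
under eq_bigr => i _ do rewrite enum_rankK.
rewrite -(pair_bigA _ (fun (_ : 'I_s) (i : 'I_n) => 'X_i ^+ k)) /=.
by rewrite sumr_const card_ord.
Qed.

Lemma repeated_adams q f :
  repeated (adams q f) = repeated f \mPo power_vars R q n.
Proof.
rewrite /repeated at_vars_adams !comp_mpoly_comp; congr (_ \mPo _).
apply: eq_from_tnth => i; rewrite !tnth_mktuple rmorphXn /= !comp_mpolyXU -!tnth_nth.
by rewrite !tnth_mktuple.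
Qed.

End RepeatedVariables.

(** * Spans of products of generators *)

Section Span.
Variable R : comNzRingType.
Implicit Types (g : nat -> symfun R) (f : symfun R).

Definition in_span g d f :=
  exists c : 'P_d -> R, f = \sum_l c l *: \prod_(k <- parts l) g k.

Lemma in_span_sum g d I r (P : pred I) (F : I -> symfun R) :
  (forall i, P i -> in_span g d (F i)) -> in_span g d (\sum_(i <- r | P i) F i).
Proof.
move=> sF; elim/big_ind: _ => //.
  by exists (fun=> 0); rewrite big1 // => l _; rewrite scale0r.
move=> _ _ [c ->] [c' ->]; exists (fun l => c l + c' l).
by rewrite -big_split /=; apply: eq_bigr => l _; rewrite scalerDl.
Qed.

Lemma in_spanZ g d a f : in_span g d f -> in_span g d (a *: f).
Proof.
move=> [c ->]; exists (fun l => a * c l); rewrite scaler_sumr.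
by apply: eq_bigr => l _; rewrite scalerA.
Qed.

Lemma in_spanD g d f f' : in_span g d f -> in_span g d f' -> in_span g d (f + f').
Proof.
move=> sf sf'.
have := @in_span_sum g d bool [:: true; false] predT (fun b => if b then f else f').
by rewrite !big_cons big_nil addr0 /=; apply => -[].
Qed.

Lemma in_spanN g d f : in_span g d f -> in_span g d (- f).
Proof. by rewrite -scaleN1r; apply: in_spanZ. Qed.

Lemma in_span_prod g (s : seq nat) : 0%N \notin s ->
  in_span g (sumn s) (\prod_(k <- s) g k).
Proof.
move=> s0; pose l := part_of s0 erefl.
exists (fun m => (m == l)%:R); rewrite (bigD1 l) //= eqxx scale1r [X in _ = _ + X]big1 ?addr0.
  by apply/esym/perm_big/perm_part_of.
by move=> m /negPf ->; rewrite scale0r.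
Qed.

Lemma in_spanM g d e f f' :
  in_span g d f -> in_span g e f' -> in_span g (d + e) (f * f').
Proof.
move=> [c ->] [c' ->]; rewrite big_distrlr; apply: in_span_sum => l _.
apply: in_span_sum => m _; rewrite /= -scalerAl -scalerAr !scalerA; apply: in_spanZ.
have [_ l0 ld] := intpartP l; have [_ m0 md] := intpartP m.
rewrite -big_cat -{1}ld -{1}md -sumn_cat; apply: in_span_prod.
by rewrite mem_cat negb_or l0 m0.
Qed.

Lemma in_span_gen g k : (0 < k)%N -> in_span g k (g k).
Proof.
move=> k0; have := @in_span_prod g [:: k].
by rewrite big_seq1 /= addn0; apply; rewrite inE eq_sym -lt0n.
Qed.

Lemma in_span1 g : in_span g 0 1.
Proof. by have := @in_span_prod g [::] isT; rewrite big_nil. Qed.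

Lemma in_span_trans g g' d f : (forall k, (0 < k)%N -> in_span g' k (g k)) ->
  in_span g d f -> in_span g' d f.
Proof.
move=> gg' [c ->]; apply: in_span_sum => l _; apply: in_spanZ.
have [_ + ld] := intpartP l; rewrite -[in in_span _ d]ld.
elim: (parts l) => [_|k s IH]; first by rewrite big_nil; apply: in_span1.
rewrite in_cons negb_or => /andP[k0 /IH sP]; rewrite big_cons.
by apply: in_spanM => //; apply: gg'; rewrite lt0n eq_sym.
Qed.

End Span.

Lemma complete_in_span (R : comNzRingType) k :
  in_span (@sesym R) k (complete R k).
Proof.
elim/ltn_ind: k => -[|k] IH; first by rewrite complete0; apply: in_span1.
rewrite completeS; apply/in_spanN/in_span_sum => j _.
have kE : (k.+1 = j.+1 + (k - j))%N by have := ltn_ord j; lia.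
rewrite [X in in_span _ X]kE.
apply: in_spanM; first exact: in_span_gen.
by apply: IH; rewrite ltnS leq_subr.
Qed.

Lemma sesym_in_span_complete (R : comNzRingType) k :
  in_span (@complete R) k (sesym R k).
Proof.
elim/ltn_ind: k => -[|k] IH; first by rewrite sesym0; apply: in_span1.
rewrite sesymS; apply: in_spanD; first exact/in_spanN/in_span_gen.
apply/in_spanN/in_span_sum => j _.
have kE : (k.+1 = j.+1 + (k - j))%N by have := ltn_ord j; lia.
rewrite [X in in_span _ X]kE.
apply: in_spanM; first by apply: IH; have := ltn_ord j; lia.
by apply: in_span_gen; rewrite subn_gt0.
Qed.

Lemma sesym_in_span_psum (K : numFieldType) k :
  in_span (@psum K) k (sesym K k).
Proof.
elim/ltn_ind: k => -[|k] IH; first by rewrite sesym0; apply: in_span1.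
have k0 : (k.+1)%:R != 0 :> K by rewrite pnatr_eq0.
rewrite -[sesym K k.+1]scale1r -(mulVf k0) -scalerA scaler_nat; apply: in_spanZ.
rewrite newton_sesym; apply/in_spanN/in_span_sum => j _ /=.
have kE : (k.+1 = j.+1 + (k - j))%N by have := ltn_ord j; lia.
rewrite [X in in_span _ X]kE.
apply: in_spanM; first exact: in_span_gen.
by apply: IH; rewrite ltnS leq_subr.
Qed.

(** A monomial in generators of degrees 1, ..., n, as the list of the degrees of its
    factors. *)
Definition mnm_seq n (m : 'X_{1..n}) : seq nat :=
  flatten [seq nseq (m i) i.+1 | i <- enum 'I_n].

Lemma big_mnm_seq (A : comNzRingType) n (m : 'X_{1..n}) (g : nat -> A) :
  \prod_(k <- mnm_seq m) g k = \prod_(i < n) g i.+1 ^+ m i.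
Proof.
rewrite /mnm_seq big_flatten big_map big_enum /=; apply: eq_bigr => i _.
by rewrite big_nseq -Monoid.iteropE.
Qed.

Lemma sumn_mnm_seq n (m : 'X_{1..n}) : sumn (mnm_seq m) = mnmwgt m.
Proof.
rewrite /mnm_seq sumn_flatten sumnE big_map big_map big_enum /=; apply: eq_bigr => i _.
by rewrite sumn_nseq mulnC.
Qed.

Lemma mnm_seq_gt0 n (m : 'X_{1..n}) : 0%N \notin mnm_seq m.
Proof.
apply/negP => /flattenP[s /mapP[i _ ->]].
by rewrite mem_nseq andbF.
Qed.

Lemma mesym_sesym (R : comNzRingType) n k :
  mesym n R k = (-1) ^+ k *: at_vars n (sesym R k).
Proof.
rewrite at_vars_sesym coef_prod_mesym -mul_mpolyC rmorphXn rmorphN1 mulrA.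
by rewrite -exprMn mulrNN mulr1 expr1n mul1r.
Qed.

(** The monomials of weight d in e_1, ..., e_d are the products of the e_k over the
    parts k of a partition of d. *)
Lemma sym_in_sesym_span (R : comNzRingType) d (f : {mpoly R[d]}) :
  f \is symmetric -> f \is d.-homog ->
  exists c : 'P_d -> R, f = at_vars d (\sum_l c l *: \prod_(k <- parts l) sesym R k).
Proof.
move=> fs fd; have [t [<- /dhomogP td]] := sym_fundamental_homog fs fd.
suff [c Ec] : in_span (sesym R) d (\sum_(a <- msupp t) ((-1) ^+ d * t@_a) *:
    \prod_(k <- mnm_seq a) sesym R k).
  exists c; rewrite -Ec raddf_sum comp_mpolyE /=; apply: eq_big_seq => a at_.
  rewrite linearZ /= big_mnm_seq rmorph_prod /= mulrC -scalerA; congr (_ *: _).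
  have -> : (-1 : R) ^+ d = \prod_(i < d) ((-1) ^+ i.+1) ^+ a i.
    have tdE : mnmwgt a = d := td _ at_.
    rewrite -[X in _ ^+ X]tdE /mnmwgt -prodrXr.
    by apply: eq_bigr => i _; rewrite -exprM mulnC.
  rewrite -scaler_prod; apply: eq_bigr => i _.
  by rewrite tnth_mktuple mesym_sesym rmorphXn exprZn.
rewrite big_seq; apply: in_span_sum => a at_; apply: in_spanZ.
have tdE : mnmwgt a = d := td _ at_.
rewrite -[X in in_span _ X]tdE -sumn_mnm_seq.
exact/in_span_prod/mnm_seq_gt0.
Qed.

Lemma in_degree_in_span (R : comNzRingType) d (f : symfun R) :
  in_degree d f -> in_span (sesym R) d f.
Proof.
move=> fd; have [c Ec] := sym_in_sesym_span (at_vars_sym d f) (fd d).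
exists c; apply: (@at_vars_inj R d) => //; apply: in_degree_sum => l _.
apply: in_degreeZ; have [_ l0 ld] := intpartP l; rewrite -[in in_degree d]ld.
by apply: in_degree_prod => // k _; apply: in_degree_sesym.
Qed.

(** * Monomial coefficients of a basis *)

Definition exponents n (m : 'X_{1..n}) : seq nat := [seq m i | i <- enum 'I_n].

Lemma exponents_perm n (m : 'X_{1..n}) (s : 'S_n) :
  perm_eq (exponents [multinom m (s i) | i < n]) (exponents m).
Proof.
rewrite /exponents (eq_map (g := m \o s)); last by move=> i; rewrite mnmE.
rewrite map_comp; apply: perm_map; apply: uniq_perm.
- by rewrite map_inj_uniq ?enum_uniq //; apply: perm_inj.
- exact: enum_uniq.
move=> i; rewrite [RHS]mem_enum inE; apply/mapP; exists ((s^-1)%g i).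
  by rewrite mem_enum.
by rewrite permKV.
Qed.

Lemma sumn_exponents n (m : 'X_{1..n}) : sumn (exponents m) = mdeg m.
Proof. by rewrite sumnE big_map mdegE big_enum. Qed.

Lemma perm_exponents_mdeg n (m m' : 'X_{1..n}) :
  perm_eq (exponents m) (exponents m') -> mdeg m = mdeg m'.
Proof. by move=> /sumn_perm; rewrite !sumn_exponents. Qed.

Section MonomialSymmetric.
Variables (R : comNzRingType) (n : nat).

(* The bound on the degrees only serves to make the index type finite. *)
Definition monomial_sym (m0 : 'X_{1..n}) : {mpoly R[n]} :=
  \sum_(m : 'X_{1..n < (mdeg m0).+1} | perm_eq (exponents m) (exponents m0)) 'X_[m].

Lemma mcoeff_monomial_sym m0 m :
  (monomial_sym m0)@_m = (perm_eq (exponents m) (exponents m0))%:R.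
Proof.
rewrite raddf_sum /=; case: (boolP (perm_eq _ _)) => [mm0|nmm0].
  have hm : (mdeg m < (mdeg m0).+1)%N by rewrite (perm_exponents_mdeg mm0).
  rewrite (bigD1 (BMultinom hm)) //= mcoeffX eqxx big1 ?addr0 // => m' /andP[_ ne].
  rewrite mcoeffX; case: eqP => // E; case/eqP: ne; exact: val_inj.
rewrite big1 // => m' h; rewrite mcoeffX; case: eqP => // E.
by rewrite -E h in nmm0.
Qed.

Lemma monomial_sym_symmetric m0 : monomial_sym m0 \is symmetric.
Proof.
apply/issymP => s; apply/mpolyP => m; rewrite mcoeff_sym !mcoeff_monomial_sym.
by rewrite (permPl (exponents_perm m s)).
Qed.

Lemma monomial_sym_homog m0 : monomial_sym m0 \is (mdeg m0).-homog.
Proof.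
apply: rpred_sum => m /perm_exponents_mdeg E.
by rewrite dhomogX /= E.
Qed.

End MonomialSymmetric.

Definition part_mnm d (l : seq nat) : 'X_{1..d} := [multinom nth 0%N l i | i < d].

Lemma exponents_part_mnm d (l : 'P_d) :
  exponents (part_mnm d l) = l ++ nseq (d - size l) 0%N.
Proof.
have [_ l0 ld] := intpartP l.
have sl : (size l <= d)%N by rewrite -[X in (_ <= X)%N]ld size_le_sumn.
apply: (@eq_from_nth _ 0%N).
  by rewrite size_map size_enum_ord size_cat size_nseq subnKC.
rewrite size_map size_enum_ord => i id_.
rewrite (nth_map (Ordinal id_)) ?size_enum_ord // mnmE nth_enum_ord //.
by rewrite nth_cat; case: ltnP => // h; rewrite nth_nseq if_same nth_default.
Qed.

Lemma mdeg_part_mnm d (l : 'P_d) : mdeg (part_mnm d l) = d.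
Proof.
have [_ _ ld] := intpartP l.
by rewrite -sumn_exponents exponents_part_mnm sumn_cat sumn_nseq mul0n addn0.
Qed.

Lemma perm_part_mnm d (l l' : 'P_d) :
  perm_eq (exponents (part_mnm d l)) (exponents (part_mnm d l')) = (l == l').
Proof.
apply/idP/eqP => [|-> //]; rewrite !exponents_part_mnm => /seq.permP ll'.
apply/intpart_perm/count_mem_perm => x.
have [_ l0 _] := intpartP l; have [_ l0' _] := intpartP l'.
have [->|x0] := eqVneq x 0%N; first by rewrite !(count_memPn _).
by have := ll' (pred1 x); rewrite !count_cat !count_nseq /= eq_sym (negPf x0) !mul0n !addn0.
Qed.

Section Matrices.
Variable d : nat.

Local Notation N := #|{: 'P_d}|.

Definition part_at (i : 'I_N) : 'P_d := enum_val i.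

Lemma part_at_inj : injective part_at.
Proof. exact: enum_val_inj. Qed.

Lemma sum_part_at (V : nmodType) (F : 'P_d -> V) :
  \sum_(l : 'P_d) F l = \sum_(i < N) F (part_at i).
Proof.
rewrite (reindex part_at) //=; exists enum_rank => i _; first exact: enum_valK.
exact: enum_rankK.
Qed.

Definition part_prod (R : comNzRingType) (g : nat -> symfun R) (i : 'I_N) : symfun R :=
  \prod_(k <- part_at i) g k.

Lemma in_spanP (R : comNzRingType) (g : nat -> symfun R) f :
  in_span g d f <-> exists c : 'I_N -> R, f = \sum_i c i *: part_prod g i.
Proof.
split=> [[c ->]|[c ->]].
  by exists (c \o part_at); rewrite sum_part_at.
exists (fun l => c (enum_rank l)); rewrite sum_part_at.
by apply: eq_bigr => i _; rewrite enum_valK.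
Qed.

Lemma in_span_matrix (R : comNzRingType) (g : nat -> symfun R) (I : finType)
    (f : I -> symfun R) :
  (forall i, in_span g d (f i)) ->
  exists c : I -> 'I_N -> R, forall i, f i = \sum_j c i j *: part_prod g j.
Proof.
move=> fg; have {}fg i : exists c : 'I_N -> R, f i = \sum_j c j *: part_prod g j.
  exact/in_spanP.
by have [c cP] := choice fg; exists c.
Qed.

Lemma in_degree_part_prod (R : comNzRingType) (g : nat -> symfun R) i :
  (forall k, (0 < k)%N -> in_degree k (g k)) -> in_degree d (part_prod g i).
Proof.
move=> dg; have [_ l0 ld] := intpartP (part_at i).
by rewrite -[X in in_degree X _]ld; apply: in_degree_prod.
Qed.

Lemma in_span_part_prod (R : comNzRingType) (g g' : nat -> symfun R) i :
  (forall k, (0 < k)%N -> in_span g' k (g k)) -> in_span g' d (part_prod g i).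
Proof.
move=> gg'; apply: in_span_trans gg' _; apply/in_spanP.
exists (fun j => (j == i)%:R); rewrite (bigD1 i) //= eqxx scale1r.
by rewrite big1 ?addr0 // => j /negPf ->; rewrite scale0r.
Qed.

Definition coef_mx (R : comNzRingType) (u : symfun R -> {mpoly R[d]})
    (f : 'I_N -> symfun R) : 'M[R]_N :=
  \matrix_(i, j) (u (f j))@_(part_mnm d (part_at i)).

Lemma coef_mx_mul (R : comNzRingType) (u : {linear symfun R -> {mpoly R[d]}})
    (f g : 'I_N -> symfun R) (c : 'I_N -> 'I_N -> R) :
  (forall i, f i = \sum_j c i j *: g j) ->
  coef_mx u f = coef_mx u g *m (\matrix_(i, j) c i j)^T.
Proof.
move=> fg; apply/matrixP => i j; rewrite !mxE fg linear_sum raddf_sum /=.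
by apply: eq_bigr => k _; rewrite linearZ /= mcoeffZ !mxE mulrC.
Qed.

(** The coefficient of x ^ l in the monomial symmetric polynomial of l' is 1 if l = l'
    and 0 otherwise, and the monomial symmetric polynomials are combinations of the
    products of elementary ones, which gives an inverse. *)
Lemma coef_mx_sesym_unit (R : comUnitRingType) :
  coef_mx (at_vars d) (part_prod (sesym R)) \in unitmx.
Proof.
have H i : exists c : 'I_N -> R, monomial_sym R (part_mnm d (part_at i)) =
    \sum_j c j *: at_vars d (part_prod (sesym R) j).
  have [c Ec] := sym_in_sesym_span (monomial_sym_symmetric R (part_mnm d (part_at i)))
    (etrans (congr1 (fun e => _ \is e.-homog) (esym (mdeg_part_mnm (part_at i))))
            (monomial_sym_homog R (part_mnm d (part_at i)))).
  exists (c \o part_at); rewrite Ec sum_part_at raddf_sum /=; apply: eq_bigr => j _.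
  by rewrite linearZ.
have [c cP] := choice H.
have E : coef_mx (at_vars d) (part_prod (sesym R)) *m (\matrix_(i, j) c i j)^T = 1%:M.
  apply/matrixP => i j; rewrite !mxE.
  transitivity ((monomial_sym R (part_mnm d (part_at j)))@_(part_mnm d (part_at i))).
    rewrite cP raddf_sum /=; apply: eq_bigr => k _.
    by rewrite !mxE mcoeffZ mulrC.
  by rewrite mcoeff_monomial_sym perm_part_mnm (inj_eq part_at_inj).
by have [] := mulmx1_unit E.
Qed.

Lemma sesym_free (R : comUnitRingType) (c c' : 'I_N -> R) :
  \sum_i c i *: part_prod (sesym R) i = \sum_i c' i *: part_prod (sesym R) i ->
  c =1 c'.
Proof.
set M := coef_mx (at_vars d) (part_prod (sesym R)) => E.
have H (b : 'I_N -> R) i : (M *m (\col_j b j)) i 0 =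
    (at_vars d (\sum_j b j *: part_prod (sesym R) j))@_(part_mnm d (part_at i)).
  rewrite mxE raddf_sum /= raddf_sum; apply: eq_bigr => j _ /=.
  by rewrite linearZ /= !mxE mulrC.
have : M *m (\col_j c j) = M *m (\col_j c' j).
  by apply/matrixP => i j; rewrite (ord1 j) !H E.
move/(congr1 (mulmx (invmx M))); rewrite !mulKmx ?coef_mx_sesym_unit //.
by move=> /matrixP cc' i; have := cc' i 0; rewrite !mxE.
Qed.

End Matrices.

(** * The form as a coefficient extraction *)

Lemma count_mnm_seq n (m : 'X_{1..n}) (i : 'I_n) : count_mem i.+1 (mnm_seq m) = m i.
Proof.
rewrite /mnm_seq count_flatten sumnE big_map big_map big_enum /= (bigD1 i) //=.
rewrite count_nseq /= eqxx mul1n big1 ?addn0 // => j ji.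
by rewrite count_nseq /= eqSS (inj_eq val_inj) (negPf ji).
Qed.

Lemma size_mnm_seq n (m : 'X_{1..n}) : size (mnm_seq m) = mdeg m.
Proof.
rewrite /mnm_seq size_flatten /shape sumnE big_map big_map big_enum mdegE /=.
by apply: eq_bigr => i _; rewrite size_nseq.
Qed.

Lemma mem_mnm_seq n (m : 'X_{1..n}) k :
  k \in mnm_seq m -> exists i : 'I_n, k = i.+1.
Proof.
move=> /flattenP[s /mapP[i _ ->]].
by rewrite mem_nseq => /andP[_ /eqP ->]; exists i.
Qed.

Lemma zpart_mnm_seq n (m : 'X_{1..n}) :
  zpart (sort geq (mnm_seq m)) = (\prod_(i < n) (i.+1 ^ m i * (m i)`!))%N.
Proof.
pose F k := (k ^ count_mem k (mnm_seq m) * (count_mem k (mnm_seq m))`!)%N.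
have cE k : count_mem k (sort geq (mnm_seq m)) = count_mem k (mnm_seq m).
  by apply/seq.permP; rewrite perm_sort.
transitivity (\prod_(k <- undup (sort geq (mnm_seq m))) F k)%N.
  by apply: eq_bigr => k _; rewrite /F !cE.
rewrite (eq_bigr (fun i : 'I_n => F i.+1)); last first.
  by move=> i _; rewrite /F count_mnm_seq.
rewrite -(big_map (fun i : 'I_n => i.+1) predT F) /=.
set s := map _ _.
rewrite [RHS](bigID (mem (mnm_seq m))) /= [X in (_ * X)%N]big1 ?muln1; last first.
  by move=> k /count_memPn E; rewrite /F E expn0 fact0 muln1.
rewrite -[RHS]big_filter; apply: perm_big; apply: uniq_perm.
- exact: undup_uniq.
- by rewrite filter_uniq // map_inj_uniq ?index_enum_uniq // => i j [/val_inj].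
move=> k; rewrite mem_undup mem_sort mem_filter.
case: (boolP (k \in mnm_seq m)) => //= /mem_mnm_seq[i ->].
by rewrite map_f // mem_index_enum.
Qed.

Lemma mderiv_prod (R : comNzRingType) n (i : 'I_n) (I : eqType) (r : seq I)
    (F : I -> {mpoly R[n]}) : uniq r ->
  mderiv i (\prod_(t <- r) F t) =
    \sum_(t <- r) mderiv i (F t) * \prod_(u <- r | u != t) F u.
Proof.
elim: r => [_|x r IH] /=; first by rewrite !big_nil -[1]/(1%:MP) mderivC.
move=> /andP[xr ur]; rewrite !big_cons mderivM IH // eqxx /=; congr (_ * _ + _).
  rewrite [RHS]big_seq_cond [LHS]big_seq; apply: eq_bigl => u.
  by case: eqVneq => [->|]; rewrite ?(negPf xr) ?andbT.
rewrite mulr_sumr [LHS]big_seq [RHS]big_seq; apply: eq_bigr => t tr.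
rewrite big_cons; case: eqVneq => [xt|_]; last by rewrite mulrCA.
by rewrite xt tr in xr.
Qed.

Lemma mcoeff_XM (R : comNzRingType) n (p : {mpoly R[n]}) (m k : 'X_{1..n}) :
  ('X_[m] * p)@_k = if (m <= k)%MM then p@_(k - m) else 0.
Proof.
rewrite mulrC; case: ifP => mk; first by rewrite -{1}(submK mk) addmC mcoeffMX.
rewrite mcoeffM big1 // => -[k1 k2] /= /eqP E; rewrite mcoeffX.
case: eqP => [mE|_]; last by rewrite mulr0.
by case/negP: mk; rewrite E -mE lem_addl.
Qed.

Section PowerSumPolynomials.
Variables (C : numFieldType) (s : nat) (form : {biscalar symfun C}).
Hypothesis form_ps : is_scaled_form s form.

Let formDl g : {morph form^~ g : f f' / f + f'}. Proof. exact: linearDl. Qed.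
Let formDr f : {morph form f : g g' / g + g'}. Proof. exact: linearDr. Qed.
Let formZl a f g : form (a *: f) g = a * form f g. Proof. exact: linearZl_LR. Qed.
Let formZr a f g : form f (a *: g) = a * form f g. Proof. exact: linearZr_LR. Qed.
Let form0l g : form 0 g = 0. Proof. exact: linear0l. Qed.
Let form0r f : form f 0 = 0. Proof. exact: linear0r. Qed.

Let form_suml (I : Type) (r : seq I) (F : I -> symfun C) g :
  form (\sum_(i <- r) F i) g = \sum_(i <- r) form (F i) g.
Proof. exact: (big_morph (form^~ g) (formDl g) (form0l g)). Qed.

Variable m : nat.

(** The form is understood on polynomials in p_1, ..., p_m, where one can
    differentiate with respect to the p_k. *)
Definition psum_eval (q : {mpoly C[m]}) : symfun C :=
  mmap (GRing.in_alg (symfun C)) (fun i : 'I_m => psum C i.+1) q.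
HB.instance Definition _ := GRing.RMorphism.copy psum_eval
  (mmap (GRing.in_alg (symfun C)) (fun i : 'I_m => psum C i.+1)).

Lemma psum_evalZ a q : psum_eval (a *: q) = a *: psum_eval q.
Proof. by rewrite /psum_eval mmapZ /= mulr_algl. Qed.

Lemma psum_evalX a : psum_eval 'X_[a] = \prod_(k <- mnm_seq a) psum C k.
Proof. by rewrite /psum_eval mmapX big_mnm_seq. Qed.

Lemma psum_evalXU i : psum_eval 'X_i = psum C i.+1.
Proof. by rewrite /psum_eval mmapX mmap1U. Qed.

Definition mnm_norm (a : 'X_{1..m}) : nat := \prod_(i < m) ((s * i.+1) ^ a i * (a i)`!).

Lemma form_mnm a b :
  form (psum_eval 'X_[a]) (psum_eval 'X_[b]) = if a == b then (mnm_norm a)%:R else 0.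
Proof.
have E c : psum_eval 'X_[c] = psum_part C (sort geq (mnm_seq c)).
  by rewrite psum_evalX; apply: perm_big; rewrite perm_sym perm_sort.
have isp (c : 'X_{1..m}) : is_part (sort geq (mnm_seq c)).
  rewrite /is_part mem_sort mnm_seq_gt0 andbT.
  by rewrite sort_sorted //= => x y; apply: leq_total.
rewrite !E form_ps.2 //.
have -> : (sort geq (mnm_seq a) == sort geq (mnm_seq b)) = (a == b).
  apply/eqP/eqP => [ab|-> //]; apply/mnmP => i; rewrite -!count_mnm_seq.
  have perm_s := perm_sort geq; have := perm_s (mnm_seq a) (mnm_seq a).
  rewrite perm_refl ab => /seq.permP/(_ (pred1 i.+1)) <-.
  by apply/seq.permP; rewrite perm_sort.
case: ifP => // _; congr (_%:R); rewrite size_sort size_mnm_seq zpart_mnm_seq mdegE.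
rewrite expn_sum -big_split; apply: eq_bigr => i _ /=.
by rewrite mulnA expnMn.
Qed.

(** On monomials in the power sums, this is the recurrence m! = m (m - 1)! for the
    factorials in the squared norms. *)
Lemma form_adjoint (k : 'I_m) f g :
  form (psum_eval ('X_k * f)) (psum_eval g) =
  (s * k.+1)%:R * form (psum_eval f) (psum_eval (mderiv k g)).
Proof.
elim/mpolyind: f => [|c a f _ _ IH]; first by rewrite mulr0 rmorph0 !form0l mulr0.
rewrite mulrDr !rmorphD /= !formDl IH mulrDr; congr (_ + _).
rewrite -scalerAr !psum_evalZ !formZl mulrCA; congr (_ * _).
elim/mpolyind: g {IH} => [|e b g _ _ IH]; first by rewrite mderiv0 rmorph0 !form0r mulr0.
rewrite mderivD !rmorphD /= !formDr IH mulrDr; congr (_ + _).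
rewrite mderivZ !psum_evalZ !formZr mulrCA; congr (_ * _).
rewrite mderivX psum_evalZ formZr -mpolyXD !form_mnm.
have [bk|bk] := posnP (b k).
  rewrite bk mul0r mulr0; case: eqP => // E; move: bk.
  by rewrite -E mnmDE mnm1E eqxx.
have Eb : (U_(k) + (b - U_(k)) = b)%MM by rewrite addmC submK // lep1mP -lt0n.
case: eqP => [<-|ne]; last first.
  case: eqP => [E|_]; last by rewrite !mulr0.
  by case: ne; rewrite E.
rewrite [(U_(k) + a)%MM]addmC addmK eqxx -!natrM; congr (_%:R).
rewrite /mnm_norm (bigD1 k) //= [in RHS](bigD1 k) //= !mnmDE mnm1E eqxx.
rewrite [X in (_ * X)%N](eq_bigr (fun i : 'I_m => (s * i.+1) ^ a i * (a i)`!)%N).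
  rewrite addn1 factS expnS; set X := \prod_(i | _) _.
  by set Y := ((s * _) ^ _)%N; lia.
by move=> i ik; rewrite mnmDE mnm1E eq_sym (negPf ik) addn0.
Qed.

Lemma form_eval1 f : form (psum_eval f) 1 = f@_0%MM.
Proof.
have one : (1 : symfun C) = psum_eval 'X_[0] by rewrite mpolyX0 rmorph1.
elim/mpolyind: f => [|c a f _ _ IH]; first by rewrite rmorph0 form0l mcoeff0.
rewrite rmorphD /= formDl IH mcoeffD psum_evalZ formZl mcoeffZ one form_mnm mcoeffX.
congr (_ * _ + _); case: eqP => // ->.
by rewrite /mnm_norm big1 // => i _; rewrite mnm0E expn0 fact0.
Qed.

Definition power_var (j : nat) : {mpoly C[m]} :=
  if j is j'.+1 then (if insub j' is Some i then 'X_i else 0) else 0.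

(** The relations k h_k = p_1 h_(k-1) + ... + p_k h_0, solved for h_k. *)
Definition completeP : nat -> {mpoly C[m]} :=
  recurrent (fun k => (k%:R^-1)%:MP) power_var.

Lemma completeP_S k :
  k.+1%:R *: completeP k.+1 = \sum_(j < k.+1) power_var j.+1 * completeP (k - j).
Proof.
rewrite /completeP recurrentS mul_mpolyC scalerA mulfV ?scale1r //.
by rewrite pnatr_eq0.
Qed.

Lemma psum_eval_completeP k : (k <= m)%N -> psum_eval (completeP k) = complete C k.
Proof.
elim/ltn_ind: k => -[|k] IH km; first by rewrite /psum_eval rmorph1.
apply: (@scalerI _ _ k.+1%:R); first by rewrite pnatr_eq0.
rewrite -psum_evalZ completeP_S scaler_nat newton_complete rmorph_sum /=.
apply: eq_bigr => j _; rewrite rmorphM /= IH ?ltnS ?leq_subr //; last first.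
  by apply: leq_trans (leq_subr _ _) (ltnW km).
have jm : (j < m)%N by apply: leq_trans (ltn_ord j) km.
by rewrite insubT /= psum_evalXU.
Qed.

Lemma completeP_mcoeff0 k : (completeP k)@_0%MM = (k == 0)%:R.
Proof.
elim/ltn_ind: k => -[|k] IH; first by rewrite /completeP recurrent0 mcoeff1 eqxx.
have /(congr1 (fun q => q@_0%MM)) := completeP_S k.
rewrite mcoeffZ raddf_sum big1 => [/eqP|j _ /=].
  by rewrite mulf_eq0 pnatr_eq0 => /eqP.
rewrite rmorphM /= [X in X * _](_ : _ = 0) ?mul0r //.
case: insubP => [i _ _|_]; last by rewrite mcoeff0.
by rewrite mcoeffX; case: eqP => // /(congr1 mdeg); rewrite mdeg1 mdeg0.
Qed.

(** Apply k d/dp_k to n h_n = p_1 h_(n-1) + ... + p_n h_0: by induction the right-hand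
    side becomes k h_(n-k) + (n - k) h_(n-k). *)
Lemma mderiv_completeP (i : 'I_m) n :
  i.+1%:R *: mderiv i (completeP n) = if (i < n)%N then completeP (n - i.+1) else 0.
Proof.
elim/ltn_ind: n => -[|n] IH.
  by rewrite /completeP recurrent0 -mpolyC1 mderivC scaler0.
apply: (@scalerI _ _ n.+1%:R); first by rewrite pnatr_eq0.
rewrite scalerA mulrC -scalerA -mderivZ completeP_S (raddf_sum (mderiv i)) scaler_sumr.
rewrite (eq_bigr (fun j : 'I_n.+1 => ((j == i :> nat)%:R * i.+1%:R) *: completeP (n - j)
   + power_var j.+1 * (if (i < n - j)%N then completeP (n - j - i.+1) else 0))); last first.
  move=> j _; rewrite /= mderivM scalerDr [X in _ + X = _]scalerAr.
  rewrite IH ?ltnS ?leq_subr //; congr (_ + _).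
  rewrite scalerAl /=; case: insubP => [j' _ jj'|].
    rewrite mderivX mnm1E.
    rewrite -(inj_eq val_inj) jj'; case: eqP => [ji|_]; last first.
      by rewrite !mulr0n scale0r scaler0 !mul0r scale0r.
    have -> : j' = i by apply: val_inj; rewrite jj'.
    by rewrite -[X in (X - _)%MM]add0m addmK mpolyX0 scale1r -scalerAl !mul1r.
  rewrite mderiv0 scaler0 mul0r; case: eqP => [->|_]; last by rewrite mul0r scale0r.
  by rewrite ltn_ord.
rewrite big_split /=; case: ltnP => [ni|ni]; last first.
  rewrite !big1 ?addr0 ?scaler0 // => j _.
    by case: ltnP => [h|]; rewrite ?mulr0 //; lia.
  by case: eqP => [ji|]; rewrite ?mul0r ?scale0r //; have := ltn_ord j; lia.
rewrite subSS.
have -> : n.+1%:R *: completeP (n - i) =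
          i.+1%:R *: completeP (n - i) + (n - i)%:R *: completeP (n - i).
  by rewrite -scalerDl -natrD; congr (_%:R *: _); lia.
congr (_ + _).
  rewrite (bigD1 (Ordinal ni)) //= eqxx mul1r big1 ?addr0 // => j.
  by rewrite -(inj_eq val_inj) /= => /negPf ->; rewrite mul0r scale0r.
have -> : (n - i)%:R *: completeP (n - i) =
    \sum_(j < n - i) power_var j.+1 * completeP ((n - i).-1 - j).
  by case: (n - i)%N => [|k]; [rewrite big_ord0 scale0r | exact: completeP_S].
rewrite (big_ord_widen n.+1 (fun j => power_var j.+1 * completeP ((n - i).-1 - j)));
  last by lia.
rewrite [RHS]big_mkcond; apply: eq_bigr => j _ /=.
have -> : (i < n - j)%N = (j < n - i)%N by lia.
case: ltnP => h; last by rewrite mulr0.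
by congr (_ * completeP _); lia.
Qed.

Definition complete_mnm n (a : 'X_{1..n}) : {mpoly C[m]} :=
  \prod_(t < n) completeP (a t).

Lemma mderiv_complete_mnm (i : 'I_m) n (a : 'X_{1..n}) :
  i.+1%:R *: mderiv i (complete_mnm a) =
  \sum_(t < n) if (i < a t)%N then complete_mnm (a - U_(t) *+ i.+1) else 0.
Proof.
rewrite mderiv_prod ?index_enum_uniq // scaler_sumr; apply: eq_bigr => t _.
rewrite scalerAl mderiv_completeP; case: ltnP => h; last by rewrite mul0r.
rewrite /complete_mnm [in RHS](bigD1 t) //= mnmBE mulmnE mnm1E eqxx mul1n; congr (_ * _).
apply: eq_bigr => u ut.
by rewrite mnmBE mulmnE mnm1E eq_sym (negPf ut) mul0n subn0.
Qed.

(** The image under Psi of a monomial in the power sums. *)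
Definition scaled_psums n (b : 'X_{1..m}) : {mpoly C[n]} :=
  \prod_(i < m) ((\sum_(t < n) 'X_t ^+ i.+1) *+ s) ^+ b i.

(** Induction on b. Moving a factor p_k of the right argument to the other side turns
    it into s k d/dp_k, which lowers one of the indices of the product of complete
    functions by k; on the right, the factor s (x_1 ^ k + ... + x_n ^ k) lowers one of
    the exponents of x ^ a by k. *)
Lemma form_complete_mnm n (a : 'X_{1..n}) b :
  form (psum_eval (complete_mnm a)) (psum_eval 'X_[b]) = (scaled_psums n b)@_a.
Proof.
have [e Ee] := ubnP (mdeg b); elim: e => // e IH in b a Ee *.
have [->|b0] := eqVneq b 0%MM.
  rewrite mpolyX0 rmorph1 form_eval1 /complete_mnm rmorph_prod /=.
  have -> : scaled_psums n 0%MM = 1.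
    by rewrite /scaled_psums big1 // => i _; rewrite mnm0E expr0.
  rewrite mcoeff1; under eq_bigr => t _ do rewrite completeP_mcoeff0.
  case: eqP => [->|/eqP a0]; first by rewrite big1 // => t _; rewrite mnm0E.
  have [t at_] : exists t, a t != 0%N.
    apply/existsP; apply: contraNT a0; rewrite negb_exists => /forallP h.
    by apply/eqP/mnmP => t; rewrite mnm0E; apply/eqP; have := h t; rewrite negbK.
  by rewrite (bigD1 t) //= (negPf at_) mul0r.
have [k bk] : exists k, b k != 0%N.
  apply/existsP; apply: contraNT b0; rewrite negb_exists => /forallP h.
  by apply/eqP/mnmP => t; rewrite mnm0E; apply/eqP; have := h t; rewrite negbK.
pose b' := (b - U_(k))%MM.
have bE : b = (U_(k) + b')%MM by rewrite addmC submK // lep1mP.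
have b'e : (mdeg b' < e)%N by rewrite bE mdegD mdeg1 in Ee.
rewrite bE form_ps.1 mpolyXD form_adjoint -form_ps.1.
rewrite natrM -mulrA -formZl -psum_evalZ mderiv_complete_mnm.
rewrite /scaled_psums.
have -> : \prod_(i < m) ((\sum_(t < n) 'X_t ^+ i.+1) *+ s) ^+ (U_(k) + b')%MM i =
    ((\sum_(t < n) 'X_t ^+ k.+1) *+ s) * scaled_psums n b' :> {mpoly C[n]}.
  rewrite /scaled_psums (bigD1 k) //= [in RHS](bigD1 k) //= mulrA -exprS.
  rewrite mnmDE mnm1E eqxx; congr (_ * _); apply: eq_bigr => i ik.
  by rewrite mnmDE mnm1E eq_sym (negPf ik).
rewrite [in RHS]mulrnAl mcoeffMn -[in RHS]mulr_natl; congr (_ * _).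
rewrite rmorph_sum form_suml mulr_suml raddf_sum /=; apply: eq_bigr => t _.
rewrite mpolyXn mcoeff_XM.
have -> : (U_(t) *+ k.+1 <= a)%MM = (k < a t)%N.
  apply/mnm_lepP/idP => [/(_ t)|h u]; first by rewrite mulmnE mnm1E eqxx mul1n.
  by rewrite mulmnE mnm1E; case: eqP => [<-|]; rewrite ?mul1n ?mul0n.
case: ifP => _; last by rewrite rmorph0 form0l.
exact: IH.
Qed.

End PowerSumPolynomials.

Definition part_mult d (l : seq nat) : 'X_{1..d} := [multinom count_mem i.+1 l | i < d].

Lemma mnm_seq_part_mult d (l : 'P_d) : perm_eq (mnm_seq (part_mult d l)) l.
Proof.
have [_ l0 _] := intpartP l.
apply: count_mem_perm => -[|x]; first by rewrite !(count_memPn _) // mnm_seq_gt0.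
have [xd|dx] := ltnP x d.
  by have := count_mnm_seq (part_mult d l) (Ordinal xd); rewrite mnmE.
rewrite count_part_gt // (count_memPn _) //; apply/negP => /mem_mnm_seq[i [xi]].
by have := ltn_ord i; rewrite -xi ltnNge dx.
Qed.

Lemma prod_part_mnm (A : comNzRingType) d (l : 'P_d) (F : nat -> A) : F 0%N = 1 ->
  \prod_(t < d) F (part_mnm d l t) = \prod_(k <- l) F k.
Proof.
move=> F0; transitivity (\prod_(k <- exponents (part_mnm d l)) F k).
  by rewrite big_map big_enum.
rewrite exponents_part_mnm big_cat /= [X in _ * X]big1_seq ?mulr1 // => k.
by rewrite mem_nseq => /andP[_ /andP[_ /eqP ->]].
Qed.

(** For s = 1 the complete functions h_l are dual to the monomial ones, so that
    pairing with h_l extracts a coefficient, and <h_l, f>_s = <h_l, Psi f>_1. *)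
Lemma form_complete (C : numFieldType) s (form : {biscalar symfun C}) d
    (i : 'I_#|{: 'P_d}|) f :
  is_scaled_form s form -> in_span (psum C) d f ->
  form (part_prod (complete C) i) f =
  (repeated s d f)@_(part_mnm d (part_at i)).
Proof.
move=> form_ps [c ->]; rewrite linear_sumr (raddf_sum (@repeated C s d)) raddf_sum /=.
apply: eq_bigr => l _.
rewrite linearZr_LR linearZ /= mcoeffZ; congr (_ * _).
have -> : part_prod (complete C) i =
    psum_eval (complete_mnm C d (part_mnm d (part_at i))).
  rewrite /complete_mnm rmorph_prod /=.
  rewrite /part_prod -(prod_part_mnm (part_at i) (complete0 C)); apply: eq_bigr => t _.
  rewrite psum_eval_completeP // -[X in (_ <= X)%N](mdeg_part_mnm (part_at i)) mdegE.
  by rewrite (bigD1 t) //= leq_addr.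
rewrite -(perm_big _ (mnm_seq_part_mult l)) -psum_evalX.
rewrite (form_complete_mnm form_ps) psum_evalX big_mnm_seq; congr (_@__).
rewrite /scaled_psums rmorph_prod; apply: eq_bigr => j _.
by rewrite rmorphXn /= repeated_psum.
Qed.

(** * Lifts with divisible image *)

Section Legendre.
Variable p : nat.
Hypothesis pp : prime p.

Let p1 : (1 < p)%N := prime_gt1 pp.
Let p0 : (0 < p)%N := prime_gt0 pp.

Lemma dp0 : dp p 0 = 0%N. Proof. by rewrite /dp big_geq. Qed.

Lemma dp1 : dp p 1 = 0%N. Proof. by rewrite /dp big_nat1 divn_small. Qed.

Lemma dp_mulp m : dp p (p * m) = (m + dp p m)%N.
Proof.
have [->|m0] := posnP m; first by rewrite muln0 dp0.
rewrite /dp big_ltn ?ltnS ?muln_gt0 ?p0 // expn1 mulKn //; congr addn.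
rewrite big_add1 -/(dp p m) (@dp_widen p m (p * m).-1) //; last first.
  by rewrite -ltnS prednK ?muln_gt0 ?p0 // ltn_Pmull.
rewrite prednK ?muln_gt0 ?p0 //.
by apply: eq_bigr => i _; rewrite expnS divnMl.
Qed.

Lemma dp_expn j : dp p (p ^ j.+1) = (p * dp p (p ^ j)).+1.
Proof.
elim: j => [|j IH].
  by rewrite expn1 expn0 -[X in dp _ X = _]muln1 dp_mulp dp1 muln0.
have E := IH; rewrite expnS dp_mulp in E.
by rewrite expnS dp_mulp IH -[in RHS]E mulnDr addnS -expnS.
Qed.

Lemma dp_top_digit j m : (p ^ j <= m < p ^ j.+1)%N ->
  dp p m = (dp p (p ^ j) + dp p (m - p ^ j))%N.
Proof.
move=> /andP[jm mj]; rewrite (dp_widen jm p1) (dp_widen (leq_subr (p ^ j) m) p1).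
rewrite (dp_widen (leqnn m) p1) -big_split; apply: eq_bigr => i _ /=.
have [ij|ji] := leqP i j.
  by rewrite -{1}(subnKC jm) divnDl // dvdn_exp2l.
have mi : (m < p ^ i)%N by apply: leq_trans mj _; rewrite leq_exp2l.
by rewrite !divn_small //; [apply: leq_ltn_trans mi; lia | apply: leq_ltn_trans mi].
Qed.

End Legendre.

Lemma mpoly_dvd_coef n (f : {mpoly int[n]}) (q : nat) :
  (forall m, (q%:Z %| f@_m)%Z) -> exists y, f = y *+ q.
Proof.
move=> qf; exists (\sum_(m <- msupp f) (f@_m %/ q%:Z)%Z *: 'X_[m]).
rewrite -sumrMnl [LHS]mpolyE; apply: eq_bigr => m _.
by rewrite scalerMnl -mulr_natr natz divzK.
Qed.

Section DivisibleLifts.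
Variables (q r n : nat).
Local Notation p := q.+1.
Hypothesis pp : prime p.

Local Notation Psi := (@repeated int (p ^ r) n).

Definition divisible_by c (f : symfun int) := exists y, Psi f = y *+ p ^ c.

(** The element f replaces u modulo p, and is better than u in that p ^ c divides
    its image under Psi. *)
Definition divisible_lift e c (u f : symfun int) :=
  [/\ in_degree e f, exists2 z, in_degree e z & f = u + z *+ p & divisible_by c f].

(** Newton's identities express k e_k through the products p_i e_(k-i), and Psi(p_i) is
    p ^ r times p_i: hence p ^ r divides k Psi(e_k). *)
Lemma sesym_divisible k : (0 < k)%N -> divisible_by (r - logn p k) (sesym int k).
Proof.
move=> k0; apply: mpoly_dvd_coef => m.
have := congr1 Psi (newton_sesym int k).
rewrite raddfMn raddfN (raddf_sum Psi) /= => /(congr1 (fun f => f@_m)).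
rewrite (eq_bigr (fun j : 'I_k =>
   (at_vars n (psum int j.+1) * Psi (sesym int (k.-1 - j))) *+ p ^ r)); last first.
  by move=> j _; rewrite rmorphM /= repeated_psum // mulrnAl.
rewrite sumrMnl mcoeffMn mcoeffN mcoeffMn; set c := _@_m; set w := (\sum_(j < k) _)@_m => E.
have {E} : (p ^ r %| k * `|c|)%N.
  have : (p ^ r)%:Z * - w = k%:Z * c.
    by rewrite -[_%:Z]natz mulr_natl -[k%:Z]natz mulr_natl mulNrn E.
  by move=> /(congr1 absz); rewrite !abszM !absz_nat => <-; rewrite dvdn_mulr.
have [k' pk' kE] := pfactor_coprime pp k0; set v := logn p k in kE *.
have [rv _|vr] := leqP r v; first by rewrite (eqP (rv : (r - v == 0)%N)) dvd1z.
rewrite -{1}(subnK (ltnW vr)) expnD kE -mulnA [(p ^ v * _)%N]mulnC mulnA.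
rewrite dvdn_pmul2r ?expn_gt0 // Gauss_dvdr ?coprimeXl //.
Qed.

Lemma divisible_lift1 : divisible_lift 0 0 1 1.
Proof.
split; first exact: in_degree0_1.
  by exists 0; [move=> k; rewrite -/(at_vars k _) raddf0 dhomog0 | rewrite mul0rn addr0].
by exists 1; rewrite /repeated !rmorph1.
Qed.

Lemma divisible_liftM e c u f e' c' u' f' : in_degree e u -> 
  divisible_lift e c u f -> divisible_lift e' c' u' f' ->
  divisible_lift (e + e') (c + c') (u * u') (f * f').
Proof.
move=> du [df [z dz fE] [y yE]] [df' [z' dz' fE'] [y' yE']].
split; first exact: in_degreeM.
  exists (u * z' + z * f'); last by rewrite {1}fE {1}fE' fE'; ring.
  rewrite -[z * f']opprK; apply: in_degreeB; first exact: in_degreeM.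
  by rewrite -scaleN1r; apply/in_degreeZ/in_degreeM.
exists (y * y'); rewrite rmorphM /= yE yE' expnD; ring.
Qed.

(** If Psi(f) = p ^ c y and F is the lift of the Frobenius, Psi maps the new element to
    p ^ (p c) (y ^ p - F y), and p divides y ^ p - F y. *)
Lemma divisible_lift_step e c u f : (0 < c)%N -> in_degree e u ->
  divisible_lift e c u f ->
  divisible_lift (e * p) (p * c).+1 (u ^+ p)
    (f ^+ p - adams q f *+ p ^ (q * c)).
Proof.
move=> c0 du [df [z dz fE] [y yE]].
have dF : in_degree (e * p) (adams q f) by apply: in_degree_adams.
have nat_scale (k : nat) (g : symfun int) : g *+ k = k%:Z *: g.
  by rewrite -scaler_nat natz.
split.
- apply: in_degreeB; first exact: in_degreeX.
  by rewrite nat_scale; apply: in_degreeZ.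
- pose w := \sum_(i < p) f ^+ (p.-1 - i) * u ^+ i.
  exists (z * w - adams q f *+ p ^ (q * c).-1).
    apply: in_degreeB; last by rewrite nat_scale; apply: in_degreeZ.
    rewrite [(e * p)%N]mulnS; apply: in_degreeM => //; apply: in_degree_sum => i _.
    have -> : (e * q = e * (q - i) + e * i)%N by rewrite -mulnDr subnK // -ltnS.
    by apply: in_degreeM; apply: in_degreeX.
  rewrite mulrnBl -mulrnA -expnSr prednK; last first.
    by rewrite muln_gt0 c0 andbT; case: (q) pp.
  have -> : (z * w) *+ p = f ^+ p - u ^+ p.
    have zE : z *+ p = f - u by rewrite fE addrC addKr.
    by rewrite subrXX -mulrnAl zE.
  by ring.
have [z' yp] := frobenius_congruence y pp.
exists z'; rewrite rmorphB rmorphXn raddfMn /= repeated_adams yE raddfMn /=.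
rewrite exprMn_n -expnM yp (raddfMn (comp_mpoly _)) /= mulNrn -[X in _ - X]mulrnA -expnD.
have -> : (c + q * c = c * p)%N by rewrite mulnS [(q * c)%N]mulnC.
rewrite mulrnDl [X in X - _]addrC addrK -mulrnA -expnS.
by rewrite [(c * p)%N]mulnC.
Qed.

Lemma divisible_lift_expn k j : (0 < k)%N -> (logn p k < r)%N -> exists f,
  divisible_lift (k * p ^ j) ((r - logn p k) * p ^ j + dp p (p ^ j))
    (sesym int k ^+ (p ^ j)) f.
Proof.
move=> k0 kr; elim: j => [|j [f IH]].
  exists (sesym int k); rewrite expn0 !muln1 expr1 dp1 // addn0.
  split; [exact: in_degree_sesym | | exact: sesym_divisible].
  by exists 0; [move=> i; rewrite -/(at_vars i _) raddf0 dhomog0 | rewrite mul0rn addr0].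
have := divisible_lift_step _ _ IH; rewrite -exprM -mulnA -!expnSr => H.
eexists; rewrite dp_expn // addnS.
rewrite [((r - _) * p ^ j.+1)%N](_ : _ = p * ((r - logn p k) * p ^ j))%N.
  rewrite -mulnDr; apply: H; last exact/in_degreeX/in_degree_sesym.
  by rewrite addn_gt0 muln_gt0 subn_gt0 kr expn_gt0.
by rewrite expnS; lia.
Qed.

(** One takes the product over the base p digits of m: the exponents c of the powers
    p ^ j add up to (r - v) m plus the valuation of m!, by Legendre's formula. *)
Lemma divisible_lift_exp k m : (0 < k)%N -> exists f,
  divisible_lift (k * m) (part_exponent p r k m) (sesym int k ^+ m) f.
Proof.
move=> k0; rewrite /part_exponent; case: ltnP => kr; last first.
  exists (sesym int k ^+ m); split; first exact/in_degreeX/in_degree_sesym.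
    by exists 0; [move=> i; rewrite -/(at_vars i _) raddf0 dhomog0 | rewrite mul0rn addr0].
  by exists (Psi (sesym int k ^+ m)).
elim/ltn_ind: m => -[|m] IH.
  by exists 1; rewrite !muln0 dp0 expr0; apply: divisible_lift1.
set M := m.+1 in IH *; have p1 := prime_gt1 pp.
(* The leading digit of M is decreased by one. *)
pose j := trunc_log p M.
have jM : (p ^ j <= M < p ^ j.+1)%N by rewrite trunc_logP // trunc_log_ltn.
have [f1 H1] := divisible_lift_expn j k0 kr.
have [|f2 H2] := IH (M - p ^ j)%N; first by have := expn_gt0 p j; lia.
exists (f1 * f2); have [jM' _] := andP jM.
have := divisible_liftM (in_degreeX _ (in_degree_sesym int k)) H1 H2.
rewrite -exprD -mulnDr subnKC // (dp_top_digit pp jM).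
by rewrite addnACA -mulnDr subnKC.
Qed.

Lemma divisible_lift_part d (l : 'P_d) : exists f,
  divisible_lift d (\sum_(1 <= k < d.+1) part_exponent p r k (count_mem k l))
    (\prod_(k <- l) sesym int k) f.
Proof.
rewrite -(perm_big _ (mnm_seq_part_mult l)) big_mnm_seq big_add1 /= big_mkord.
have dE : d = (\sum_(i < d) i.+1 * part_mult d l i)%N.
  have [_ _ {1}<-] := intpartP l.
  rewrite -(sumn_perm (mnm_seq_part_mult l)) sumn_mnm_seq.
  by apply: eq_bigr => i _; rewrite mulnC.
rewrite [X in divisible_lift X]dE.
rewrite [X in divisible_lift _ X](eq_bigr (fun i : 'I_d =>
  part_exponent p r i.+1 (part_mult d l i))); last first.
  by move=> i _; rewrite mnmE.
suff [f [Hf _]] : exists f, divisible_lift (\sum_(i < d) i.+1 * part_mult d l i)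
   (\sum_(i < d) part_exponent p r i.+1 (part_mult d l i))
   (\prod_(i < d) sesym int i.+1 ^+ part_mult d l i) f /\
   in_degree (\sum_(i < d) i.+1 * part_mult d l i)
     (\prod_(i < d) sesym int i.+1 ^+ part_mult d l i).
  by exists f.
elim: (index_enum _) => [|i s [f [Hf df]]].
  by exists 1; rewrite !big_nil; split; [exact: divisible_lift1 | exact: in_degree0_1].
rewrite !big_cons; have [g Hg] := divisible_lift_exp (part_mult d l i) (ltn0Sn i).
have dg := in_degreeX (part_mult d l i) (in_degree_sesym int i.+1).
by exists (g * f); split; [apply: divisible_liftM | apply: in_degreeM].
Qed.

End DivisibleLifts.

(** * The Gram matrix and its determinant *)

Lemma smith_divisors_perm N (G : 'M[int]_N) e e' :
  perm_eq e e' -> smith_divisors G e -> smith_divisors G e'.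
Proof.
move=> ee' [L [D [dd [uL uD hd GE de]]]]; exists L, D, dd; split => //.
exact: perm_trans de ee'.
Qed.

Lemma smith_divisors_congr N (G U V : 'M[int]_N) e :
  U \in unitmx -> V \in unitmx -> smith_divisors G e -> smith_divisors (U *m G *m V) e.
Proof.
move=> uU uV [L [D [dd [uL uD hd GE de]]]]; exists (U *m L), (D *m V), dd.
by split; rewrite ?unitmx_mul ?uU ?uV ?uL ?uD ?GE ?mulmxA.
Qed.

Lemma int_mulmx1_size m n (A : 'M[int]_(m, n)) (B : 'M[int]_(n, m)) :
  A *m B = 1%:M -> (m <= n)%N.
Proof.
move=> /(congr1 (map_mx (intr : int -> rat))); rewrite map_mxM map_mx1.
exact: mulmx1_min.
Qed.

Lemma repeated_base_change (C : numDomainType) s n f :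
  repeated s n (int_base_change C f) = map_mpoly intr (repeated s n f).
Proof.
rewrite /repeated at_vars_base_change [RHS]map_mpoly_comp //; last exact: intr_inj.
congr comp_mpoly; apply: eq_from_tnth => i.
by rewrite [RHS]tnth_map !tnth_mktuple map_mpolyX.
Qed.

Local Notation bc := (@int_base_change _).

Section Gram.
Variables (d : nat).
Local Notation N := #|{: 'P_d}|.
Local Notation e := (@part_prod d int (sesym int)).

Lemma Zbasis_sesym : is_Zbasis d e.
Proof.
split=> [i|f df]; first exact: (in_degree_part_prod i (fun k _ => @in_degree_sesym int k)).
have /in_spanP[c fE] := in_degree_in_span df.
exists (\row_i c i); split; first by rewrite fE; apply: eq_bigr => i _; rewrite mxE.
move=> c' fE'; apply/rowP => i; rewrite mxE.
by rewrite (sesym_free (etrans (esym fE) fE')).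
Qed.

Lemma Zbasis_change N1 N2 (b1 : 'I_N1 -> symfun int) (b2 : 'I_N2 -> symfun int) :
  is_Zbasis d b1 -> is_Zbasis d b2 ->
  exists (U : 'M[int]_(N1, N2)) (V : 'M[int]_(N2, N1)),
    [/\ forall i, b1 i = \sum_j U i j *: b2 j, U *m V = 1%:M & V *m U = 1%:M].
Proof.
have expand n1 n2 (c1 : 'I_n1 -> symfun int) (c2 : 'I_n2 -> symfun int) :
    is_Zbasis d c1 -> is_Zbasis d c2 ->
    exists U : 'M[int]_(n1, n2), forall i, c1 i = \sum_j U i j *: c2 j.
  move=> [d1 _] [_ s2].
  have H i : exists a : 'rV[int]_n2, c1 i = \sum_j a 0 j *: c2 j.
    by have [a [aE _]] := s2 _ (d1 i); exists a.
  have [a aP] := choice H; exists (\matrix_(i, j) a i 0 j) => i.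
  by rewrite aP; apply: eq_bigr => j _; rewrite mxE.
have uniq n1 n2 (c1 : 'I_n1 -> symfun int) (c2 : 'I_n2 -> symfun int)
    (U : 'M[int]_(n1, n2)) (V : 'M[int]_(n2, n1)) : is_Zbasis d c1 ->
    (forall i, c1 i = \sum_j U i j *: c2 j) -> (forall i, c2 i = \sum_j V i j *: c1 j) ->
    U *m V = 1%:M.
  move=> [d1 s1] UE VE; apply/row_matrixP => i.
  have [a [_ aU]] := s1 _ (d1 i).
  rewrite -(aU (row i (U *m V))); last first.
    rewrite {1}UE; under eq_bigr => j _ do rewrite VE scaler_sumr.
    rewrite exchange_big; apply: eq_bigr => k _ /=; rewrite !mxE scaler_suml.
    by apply: eq_bigr => j _; rewrite scalerA.
  apply: aU; rewrite (bigD1 i) //= !mxE eqxx scale1r big1 ?addr0 // => j ji.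
  by rewrite !mxE eq_sym (negPf ji) scale0r.
move=> B1 B2; have [U UE] := expand _ _ _ _ B1 B2; have [V VE] := expand _ _ _ _ B2 B1.
by exists U, V; split => //; [exact: uniq B1 UE VE | exact: uniq B2 VE UE].
Qed.

(** The products p_l of power sums are eigenvectors of Psi, with eigenvalue s to the
    number of parts of l. The matrix that expresses them through the e_l has a
    nonzero determinant, as the form is not degenerate on the p_l. *)
Lemma det_coef_mx_repeated (C : numFieldType) s (form : {biscalar symfun C}) :
  is_scaled_form s form -> (0 < s)%N ->
  `|\det (coef_mx (@repeated int s d) e)|%N = (s ^ \sum_(i < N) size (part_at i))%N.
Proof.
move=> form_ps s0.
have [A AE] : exists A : 'I_N -> 'I_N -> int,
    forall i, part_prod (psum int) i = \sum_j A i j *: e j.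
  apply: in_span_matrix => i; apply: in_span_part_prod => k k0.
  exact/in_degree_in_span/in_degree_psum.
pose Am := \matrix_(i, j) A i j.
have detA : \det Am != 0.
  have Gp : \matrix_(i < N, j < N) form (part_prod (psum C) i) (part_prod (psum C) j) =
      map_mx intr Am *m (\matrix_(i, j) form (bc (e i)) (bc (e j))) *m (map_mx intr Am)^T.
    have pE i : part_prod (psum C) i = \sum_j (A i j)%:~R *: bc (e j).
      transitivity (@int_base_change C (part_prod (psum int) i)).
        by rewrite rmorph_prod; apply: eq_bigr => k _; rewrite -base_change_psum.
      by rewrite AE raddf_sum; apply: eq_bigr => j _; rewrite -base_changeZ.
    apply/matrixP => i j; rewrite !mxE !pE linear_sumr; apply: eq_bigr => k _.
    rewrite linearZr_LR linear_sumlz !mxE mulrC; congr (_ * _); apply: eq_bigr => l _.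
    by rewrite linearZl_LR !mxE.
  have : \det (\matrix_(i < N, j < N) form (part_prod (psum C) i) (part_prod (psum C) j)) != 0.
    pose D := \row_(i < N) form (part_prod (psum C) i) (part_prod (psum C) i).
    have pform (i j : 'I_N) : form (part_prod (psum C) i) (part_prod (psum C) j) =
        if i == j then (s ^ size (part_at i) * zpart (part_at i))%:R else 0.
      have isp (k : 'I_N) : is_part (part_at k).
        by rewrite /is_part; have [-> -> _] := intpartP (part_at k).
      rewrite -(inj_eq (@part_at_inj d)) -(inj_eq val_inj).
      exact: form_ps.2.
    rewrite (_ : \matrix_(i < N, j < N) _ = diag_mx D); last first.
      apply/matrixP => i j; rewrite !mxE !pform; case: eqP => [->|]; rewrite ?eqxx ?mulr1n //.
    rewrite det_diag; apply/prodf_neq0 => i _; rewrite !mxE pform eqxx pnatr_eq0.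
    rewrite muln_eq0 negb_or -!lt0n expn_gt0 s0 /= /zpart big_seq.
    apply: prodn_cond_gt0 => k; rewrite mem_undup muln_gt0 fact_gt0 andbT expn_gt0.
    have [_ l0 _] := intpartP (part_at i).
    by case: k => // k0; rewrite k0 in l0.
  rewrite Gp !det_mulmx det_map_mx; apply: contra_neq => ->.
  by rewrite rmorph0 !mul0r.
set K := coef_mx _ _; pose M := coef_mx (@at_vars int d) e.
pose S := diag_mx (\row_(i < N) (s ^ size (part_at i))%:R) : 'M[int]_N.
(* The coefficients of the p_l, before and after Psi. *)
have KA : K *m Am^T = M *m Am^T *m S.
  rewrite /K -(coef_mx_mul (@repeated int s d) AE) -(coef_mx_mul (@at_vars int d) AE).
  apply/matrixP => i j; rewrite mul_mx_diag !mxE mulrC mulr_natl -mcoeffMn; congr (_@__).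
  rewrite /part_prod !rmorph_prod /=; have [_ + _] := intpartP (part_at j).
  elim: (parts _) => [|k l IH] /=; first by rewrite !big_nil mulr1n.
  rewrite in_cons negb_or eq_sym => /andP[k0 /IH E]; rewrite !big_cons E.
  by rewrite repeated_psum ?lt0n // expnS mulrnAr mulrnAl -mulrnA.
have /(congr1 (fun X => \det X)) := KA.
rewrite !det_mulmx det_tr mulrAC => /(mulIf detA) ->.
rewrite abszM (absz_unit (_ : \det M \is a GRing.unit)); last first.
  by rewrite -unitmxE coef_mx_sesym_unit.
rewrite mul1n det_diag (big_morph absz abszM absz1) expn_sum.
by apply: eq_bigr => i _; rewrite mxE natz absz_nat.
Qed.

(** The e_l and the h_l are integral combinations of each other, which gives B, and
    pairing with h_l extracts a coefficient of the image under Psi. *)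
Lemma gram_sesym (C : numFieldType) s (form : {biscalar symfun C}) :
  is_scaled_form s form -> exists B : 'M[int]_N, B \in unitmx /\
  forall i j, form (bc (e i)) (bc (e j)) = ((B *m coef_mx (@repeated int s d) e) i j)%:~R.
Proof.
move=> form_ps.
have [B BE] : exists B : 'I_N -> 'I_N -> int,
    forall i, e i = \sum_j B i j *: part_prod (complete int) j.
  apply: in_span_matrix => i; apply: in_span_part_prod => k _.
  exact: sesym_in_span_complete.
have [B' BE'] : exists B : 'I_N -> 'I_N -> int,
    forall i, part_prod (complete int) i = \sum_j B i j *: e j.
  apply: in_span_matrix => i; apply: in_span_part_prod => k _.
  exact: complete_in_span.
exists (\matrix_(i, j) B i j); split.
  (* The two expansions are inverse to each other, as the e_l are independent. *)
  have BB : (\matrix_(i, j) B i j) *m (\matrix_(i, j) B' i j) = 1%:M.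
    apply/matrixP => i j.
    have := @sesym_free d int (fun k => ((\matrix_(i, j) B i j) *m (\matrix_(i, j) B' i j)) i k)
      (fun k => (1%:M : 'M_N) i k).
    apply; transitivity (e i).
      rewrite BE; under [RHS]eq_bigr => k _ do rewrite BE' scaler_sumr.
      rewrite exchange_big; apply: eq_bigr => k _ /=; rewrite !mxE scaler_suml.
      by apply: eq_bigr => l _; rewrite !mxE scalerA.
    rewrite (bigD1 i) //= !mxE eqxx scale1r big1 ?addr0 // => k ki.
    by rewrite !mxE eq_sym (negPf ki) scale0r.
  by have [] := mulmx1_unit BB.
move=> i j; rewrite {1}BE raddf_sum linear_sumlz !mxE raddf_sum; apply: eq_bigr => k _ /=.
rewrite base_changeZ linearZl_LR /= !mxE rmorphM /=; congr (_ * _).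
have -> : bc (part_prod (complete int) k) = part_prod (complete C) k.
  by rewrite rmorph_prod; apply: eq_bigr => t _; apply: base_change_complete.
have eE : bc (e j) = part_prod (sesym C) j.
  by rewrite rmorph_prod; apply: eq_bigr => t _; apply: base_change_sesym.
rewrite (form_complete _ form_ps); last first.
  by rewrite eE; apply: in_span_part_prod => t _; apply: sesym_in_span_psum.
by rewrite repeated_base_change mcoeff_map_mpoly.
Qed.

End Gram.

(** * Elementary divisors *)

Section ElementaryDivisors.
Variables (d p r : nat).
Hypothesis pp : prime p.

Local Notation N := #|{: 'P_d}|.
Local Notation e := (@part_prod d int (sesym int)).

Definition divisor_exponent (i : 'I_N) : nat :=
  \sum_(1 <= k < d.+1) part_exponent p r k (count_mem k (part_at i)).

Lemma sum_divisor_exponent :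
  (\sum_i divisor_exponent i = r * \sum_(i < N) size (part_at i))%N.
Proof.
rewrite -(sum_part_at (fun l : 'P_d => size l)) -(sum_part_exponent r d pp).
by rewrite sum_part_at.
Qed.

Lemma perm_divisors :
  perm_eq [seq (p ^ divisor_exponent i)%:Z | i : 'I_N] [seq (Dpart p r l)%:Z | l : 'P_d].
Proof.
rewrite (_ : [seq _ | i : 'I_N] =
    [seq (Dpart p r l)%:Z | l : 'P_d <- map (@part_at d) (enum 'I_N)]).
  apply: perm_map; apply: uniq_perm.
  - by rewrite map_inj_uniq ?enum_uniq //; apply: part_at_inj.
  - exact: enum_uniq.
  move=> l; rewrite [RHS]mem_enum inE; apply/mapP; exists (enum_rank l).
    by rewrite mem_enum.
  by rewrite /part_at enum_rankK.
by rewrite -map_comp; apply: eq_map => i /=; rewrite Dpart_exponent.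
Qed.

(** The lifts are congruent to the e_l modulo p, so that their coordinates form the
    identity matrix modulo p. *)
Lemma divisible_family : exists X Y : 'M[int]_N,
  ~~ (p%:Z %| \det X)%Z /\
  coef_mx (@repeated int (p ^ r) d) e *m X = Y *m diag_mx (\row_i (p ^ divisor_exponent i)%:Z).
Proof.
have pE : p = p.-1.+1 by rewrite prednK ?prime_gt0.
have H (i : 'I_N) : exists f : symfun int, [/\ exists2 z, in_degree d z & f = e i + z *+ p
    & exists y, repeated (p ^ r) d f = y *+ p ^ divisor_exponent i].
  have := @divisible_lift_part p.-1 r d; rewrite -pE => /(_ pp d (part_at i)).
  by case=> f [_]; rewrite /divisible_by -!pE => hz hy; exists f; split.
have [x xP] := choice H.
have Hz (i : 'I_N) : exists z : symfun int, in_degree d z /\ x i = e i + z *+ p.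
  by have [[z dz xE] _] := xP i; exists z.
have [z zP] := choice Hz.
have Hy (i : 'I_N) : exists y, repeated (p ^ r) d (x i) = y *+ p ^ divisor_exponent i.
  by have [_] := xP i.
have [y yP] := choice Hy.
have [Z ZE] : exists Z : 'I_N -> 'I_N -> int, forall i, z i = \sum_j Z i j *: e j.
  by apply: in_span_matrix => i; apply: in_degree_in_span; case: (zP i).
pose c i j := (i == j)%:R + Z i j *+ p.
have xE i : x i = \sum_j c i j *: e j.
  rewrite (zP i).2 ZE; under [RHS]eq_bigr => j _ do rewrite scalerDl.
  rewrite big_split /=; congr (_ + _).
    rewrite (bigD1 i) //= eqxx scale1r big1 ?addr0 // => j ji.
    by rewrite eq_sym (negPf ji) scale0r.
  by rewrite -sumrMnl; apply: eq_bigr => j _; rewrite scalerMnl.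
exists (\matrix_(i, j) c i j)^T.
exists (\matrix_(i, j) (y j)@_(part_mnm d (part_at i))); split.
  have pF := pchar_Fp pp.
  rewrite (dvdz_pcharf pF) det_tr -det_map_mx.
  rewrite (_ : map_mx _ _ = 1%:M) ?det1 ?oner_eq0 //.
  apply/matrixP => i j; rewrite !mxE rmorphD !rmorphMn rmorph1 /=.
  by rewrite -[X in _ + X]mulr_natr (pcharf0 pF) mulr0 addr0.
rewrite -(coef_mx_mul (@repeated int (p ^ r) d) xE).
apply/matrixP => i j; rewrite mul_mx_diag !mxE [X in X@__](yP j) mcoeffMn.
by rewrite -[LHS]mulr_natr natz.
Qed.

End ElementaryDivisors.

Theorem theorem1p3 (R : realType) (p r : nat) (p_prime : prime p)
    (r_range : (1 <= r <= p)%N)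
    (form : {biscalar symfun R[i]}) (form_ps : is_scaled_form (p ^ r) form)
    (d : nat) :
  elementary_divisors form d [seq (Dpart p r l)%:Z | l : 'P_d].
Proof.
split; first by exists #|{: 'P_d}|, (@part_prod d int (sesym int)); apply: Zbasis_sesym.
move=> N b Bb; have [U [V [bE UV VU]]] := Zbasis_change Bb (Zbasis_sesym d).
have NE : N = #|{: 'P_d}|.
  by apply/eqP; rewrite eqn_leq (int_mulmx1_size UV) (int_mulmx1_size VU).
subst N; have [uU _] := mulmx1_unit UV.
have [B [uB GE]] := gram_sesym d form_ps.
have [X [Y [pX XY]]] := divisible_family d r p_prime.
set K := coef_mx _ _ in GE XY; set G := B *m K in GE.
have smG : smith_divisors G [seq (Dpart p r l)%:Z | l : 'P_d].
  apply: (smith_divisors_perm (perm_divisors d r p_prime)).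
  apply: (@smith_divisors_of_divisible_family p _ G X (B *m Y)) => //.
    by rewrite -!mulmxA XY.
  rewrite det_mulmx abszM (@absz_unit (\det B)) // mul1n.
  rewrite (det_coef_mx_repeated d form_ps) ?expn_gt0 ?prime_gt0 //.
  by rewrite sum_divisor_exponent // expnM.
exists (U *m G *m U^T); last first.
  by apply: smith_divisors_congr; rewrite ?unitmx_tr.
have bcE i : int_base_change R[i] (b i) =
    \sum_j (U i j)%:~R *: int_base_change R[i] (part_prod (sesym int) j).
  by rewrite bE raddf_sum; apply: eq_bigr => j _; rewrite -base_changeZ.
apply/matrixP => i j; rewrite !mxE !bcE linear_sumr rmorph_sum.
apply: eq_bigr => k _; rewrite linearZr_LR linear_sumlz !mxE rmorphM /= mulrC.
congr (_ * _); rewrite rmorph_sum; apply: eq_bigr => l _.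
by rewrite linearZl_LR GE rmorphM.
Qed.
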